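(* Let $u \in V$ be the solution of $B(u,v) = F(v)$ for all $v \in V$, and let $u_{X\mathcal{P}} \in V_{X\mathcal{P}}$ be the Galerkin approximation satisfying $B(u_{X\mathcal{P}}, v) = F(v)$ for all $v \in V_{X\mathcal{P}}$. Let $u_{X\mathcal{P}}^* \in V_{X\mathcal{P}}^*$ satisfy $B(u_{X\mathcal{P}}^*, v) = F(v)$ for all $v \in V_{X\mathcal{P}}^*$. Suppose that the saturation assumption holds, i.e., there is a constant $\beta \in [0,1)$ such that $$\|u - u_{X\mathcal{P}}^*\|_B \le \beta\, \|u - u_{X\mathcal{P}}\|_B ,$$ and that the norm equivalence holds with positive constants $\lambda, \Lambda$: $$\lambda \|v\|_B \le \|v\|_{\widetilde B} \le \Lambda \|v\|_B \qquad \forall v \in V .$$ Let $\kappa_1, \kappa_2 \in [0,1)$ be constants in the strengthened Cauchy--Schwarz inequalities $$|\widetilde B(w,v)| \le \kappa_1 \|w\|_{\widetilde B}\|v\|_{\widetilde B}\quad \forall w \in V_{X^*\mathcal{P}},\ \forall v \in V_{X\mathcal{Q}}, \qquad |\widetilde B(w,v)| \le \kappa_2 \|w\|_{\widetilde B}\|v\|_{\widetilde B}\quad \forall w \in V_{X\mathcal{P}},\ \forall v \in V_{Y\mathcal{P}} .$$ Let $e_{Y\mathcal{P}} \in V_{Y\mathcal{P}}$ and $e_{X\mathcal{Q}} \in V_{X\mathcal{Q}}$ satisfy $$\widetilde B(e_{Y\mathcal{P}}, v) = F(v) - B(u_{X\mathcal{P}}, v)\ \ \forall v \in V_{Y\mathcal{P}},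 \qquad \widetilde B(e_{X\mathcal{Q}}, v) = F(v) - B(u_{X\mathcal{P}}, v)\ \ \forall v \in V_{X\mathcal{Q}},$$ and let $\eta := \big(\|e_{Y\mathcal{P}}\|_{\widetilde B}^2 + \|e_{X\mathcal{Q}}\|_{\widetilde B}^2\big)^{1/2}$. Then $$\frac{\lambda}{\sqrt 2}\,\eta \le \|u - u_{X\mathcal{P}}\|_B \le \frac{\Lambda}{\sqrt{1-\beta^2}\,\sqrt{(1-\kappa_1)(1-\kappa_2^2)}}\,\eta .$$ Furthermore, if $\kappa_1 = 0$ (that is, $V_{X^*\mathcal{P}}$ and $V_{X\mathcal{Q}}$ are $\widetilde B$-orthogonal), then $$\lambda\,\eta \le \|u - u_{X\mathcal{P}}\|_B \le \frac{\Lambda}{\sqrt{1-\beta^2}\,\sqrt{1-\kappa_2^2}}\,\eta .$$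
   Context: Setting. $D \subset \mathbb{R}^2$ is a bounded domain with Lipschitz polygonal boundary; $H_0^1(D)$ carries the norm $\|v\|_{H_0^1(D)} = \|\nabla v\|_{L^2(D)}$. $\Gamma = \prod_{m=1}^\infty \Gamma_m$ with $\Gamma_m = [-1,1]$. For each $m \in \mathbb{N}$, $\pi_m$ is a Borel probability measure on $\Gamma_m$ with density $q_m$, and $\pi = \prod_{m=1}^\infty \pi_m$ is the product probability measure on $\Gamma$ (with its Borel $\sigma$-algebra). $V := L^2_\pi(\Gamma; H_0^1(D))$ is the Bochner space with norm $\|v\|_V = \big(\int_\Gamma \|v(\cdot,\bm{y})\|_{H_0^1(D)}^2\, d\pi(\bm{y})\big)^{1/2}$; it is identified with the Hilbert tensor product $H_0^1(D) \otimes L^2_\pi(\Gamma)$. Bilinear form and functional. $f \in H^{-1}(D)$, and $T \in L^\infty_\pi(\Gamma; L^\infty(D))$ satisfies $0 < \alpha_{\min} \le T(\bm{x},\bm{y}) \le \alpha_{\max} < \infty$ a.e. in $D \times \Gamma$ for some constants $\alpha_{\min}, \alpha_{\max}$. Define, with $\nabla$ acting in $\bm{x}$ only, $$B(u,v) := \int_\Gamma \int_D T(\bm{x},\bm{y}) \nabla u(\bm{x},\bm{y})\cdot\nabla v(\bm{x},\bm{y})\, d\bm{x}\, d\pi(\bm{y}), \qquad F(v) := \int_\Gamma \int_D f(\bm{x}) v(\bm{x},\bm{y})\, d\bm{x}\, d\pi(\bm{y}),$$ where the inner integral in $F$ denotes the duality pairing of $f$ with $v(\cdot,\bm{y})$.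 $B$ is symmetric, continuous and elliptic on $V$; $\|v\|_B := B(v,v)^{1/2}$. Auxiliary form. $\widetilde B(\cdot,\cdot)$ is a symmetric, continuous and elliptic bilinear form on $V$; $\|v\|_{\widetilde B} := \widetilde B(v,v)^{1/2}$. Discrete spaces. Let $\mathcal{I}$ be the set of finitely supported sequences $\bm{\alpha} = (\alpha_1,\alpha_2,\dots)$ in $\mathbb{N}_0^{\mathbb{N}}$. For each $m$, $\{p_n^m\}_{n\in\mathbb{N}_0}$ are the univariate polynomials on $\Gamma_m$ ($\deg p_n^m = n$, $p_0^m = 1$) orthonormal in $L^2_{\pi_m}(\Gamma_m)$, and $p_{\bm{\alpha}}(\bm{y}) := \prod_{m=1}^\infty p^m_{\alpha_m}(y_m)$ for $\bm{\alpha}\in\mathcal{I}$; these form an orthonormal basis of $L^2_\pi(\Gamma)$. For a finite $\mathcal{R} \subset \mathcal{I}$, $P_{\mathcal{R}} := \operatorname{span}\{p_{\bm{\alpha}} : \bm{\alpha} \in \mathcal{R}\}$. $\mathcal{P}, \mathcal{Q} \subset \mathcal{I}$ are finite index sets with $\mathcal{P}\cap\mathcal{Q} = \emptyset$ and $\bm{0} \in \mathcal{P}$. $X, Y \subset H_0^1(D)$ are finite-dimensional (finite element) subspaces whose sum $X^* := X \oplus Y$ is direct. Set $V_{X\mathcal{P}} := X \otimes P_{\mathcal{P}}$, $V_{Y\mathcal{P}} := Y \otimes P_{\mathcal{P}}$, $V_{X\mathcal{Q}} := X\otimes P_{\mathcal{Q}}$, $V_{X^*\mathcal{P}} := V_{X\mathcal{P}}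 \oplus V_{Y\mathcal{P}}$ and $V_{X\mathcal{P}}^* := V_{X\mathcal{P}} \oplus V_{Y\mathcal{P}} \oplus V_{X\mathcal{Q}}$. *)

(* Defs.v *)
From HB Require Import structures.
From mathcomp Require Import all_boot all_order all_algebra finmap.
From mathcomp Require Import all_classical all_reals all_analysis.

Set Implicit Arguments.
Unset Strict Implicit.
Unset Printing Implicit Defensive.

Import Order.TTheory GRing.Theory Num.Theory.
Import numFieldNormedType.Exports.

Local Open Scope classical_set_scope.
Local Open Scope ring_scope.

Notation plane R := (R * R)%type (only parsing).

(** The plane with its Borel sigma-algebra; the carrier is that of [plane R]. *)
Notation mplane R := (measurableTypeR R * measurableTypeR R)%type (only parsing).

Definition leb2 (R : realType) : {measure set (mplane R) -> \bar R} :=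
  (@lebesgue_measure R \x @lebesgue_measure R)%E.

Definition boundary (R : realType) (D : set (plane R)) : set (plane R) :=
  closure D `\` interior D.

Definition polygonal_boundary (R : realType) (D : set (plane R)) : Prop :=
  exists s : seq (plane R * plane R), boundary D =
    [set x | exists2 ab, ab \in s & exists2 t : R, 0 <= t <= 1 &
       x = ((1 - t) * ab.1.1 + t * ab.2.1, (1 - t) * ab.1.2 + t * ab.2.2)].

(** Near each boundary point [x0], in the orthonormal frame centred at [x0] whose
    first axis is [(c, s)], the set [D] lies strictly above the graph of a
    Lipschitz function. *)
Definition lipschitz_boundary (R : realType) (D : set (plane R)) : Prop :=
  forall x0 : plane R, boundary D x0 ->
  exists (c s r h : R) (phi : R -> R),
    [/\ c ^+ 2 + s ^+ 2 = 1, 0 < r, 0 < h, lipschitz phi &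
      forall x : plane R,
        let t := c * (x.1 - x0.1) + s * (x.2 - x0.2) in
        let z := - s * (x.1 - x0.1) + c * (x.2 - x0.2) in
        `|t| < r -> `|z| < h -> (D x <-> phi t < z)].

Definition lipschitz_polygonal_domain (R : realType) (D : set (plane R)) : Prop :=
  [/\ D !=set0 /\ open D, connected D, bounded_set D,
      polygonal_boundary D & lipschitz_boundary D].

Definition pd1 (R : realType) (f : plane R -> R^o) (x : plane R) : R^o :=
  'D_((1, 0) : plane R) f x.
Definition pd2 (R : realType) (f : plane R -> R^o) (x : plane R) : R^o :=
  'D_((0, 1) : plane R) f x.

Fixpoint Ck (R : realType) (k : nat) (f : plane R -> R^o) : Prop :=
  continuous f /\
  if k is k'.+1 then
    [/\ forall x, derivable f x (1, 0), forall x, derivable f x (0, 1),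
        Ck k' (pd1 f) & Ck k' (pd2 f)]
  else True.

(** [C_c^oo(D)], extended by zero to the plane. *)
Definition test_fun (R : realType) (D : set (plane R)) (phi : plane R -> R^o) :
    Prop :=
  (forall k, Ck k phi) /\
  exists K : set (plane R), [/\ compact K, K `<=` D & forall x, ~ K x -> phi x = 0].

Definition in_L2 (R : realType) (D : set (plane R)) (g : plane R -> R^o) : Prop :=
  measurable_fun (D : set (mplane R)) (g : mplane R -> R) /\
  (leb2 R).-integrable D (fun x => ((g x) ^+ 2)%:E).

(** Elements of [H^1(D)] are represented by a function together with its weak
    gradient [(v, (g1, g2))]. Carrying the gradient avoids choosing a
    representative of it; [in_H1] forces it to be the weak gradient of [v]. *)
Notation H1fun R :=
  ((plane R -> R^o) * ((plane R -> R^o) * (plane R -> R^o)))%type (only parsing).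

Definition fval (R : realType) (v : H1fun R) (x : plane R) : R := v.1 x.
Definition gradx (R : realType) (v : H1fun R) (x : plane R) : R := v.2.1 x.
Definition grady (R : realType) (v : H1fun R) (x : plane R) : R := v.2.2 x.

Definition in_H1 (R : realType) (D : set (plane R)) (v : H1fun R) : Prop :=
  [/\ in_L2 D v.1, in_L2 D v.2.1, in_L2 D v.2.2 &
    forall phi, test_fun D phi ->
      \int[leb2 R]_(x in D) (fval v x * pd1 phi x) =
        - (\int[leb2 R]_(x in D) (gradx v x * phi x)) /\
      \int[leb2 R]_(x in D) (fval v x * pd2 phi x) =
        - (\int[leb2 R]_(x in D) (grady v x * phi x))].

(** Closure of [C_c^oo(D)] in [H^1(D)]. *)
Definition in_H10 (R : realType) (D : set (plane R)) (v : H1fun R) : Prop :=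
  in_H1 D v /\
  exists phi : nat -> plane R -> R^o, (forall n, test_fun D (phi n)) /\
    (fun n => \int[leb2 R]_(x in D)
       ((fval v x - phi n x) ^+ 2 + (gradx v x - pd1 (phi n) x) ^+ 2
        + (grady v x - pd2 (phi n) x) ^+ 2))%R @ \oo --> (0 : R).

(** [||v||_{H^1_0(D)} = ||grad v||_{L^2(D)}]. Two representatives denote the same
    element of [H^1_0(D)] when this norm of their difference vanishes ([D] being
    bounded, this is a norm by the Poincare inequality). *)
Definition normH10 (R : realType) (D : set (plane R)) (v : H1fun R) : R :=
  Num.sqrt (\int[leb2 R]_(x in D) (gradx v x ^+ 2 + grady v x ^+ 2)).

(** Finite-dimensional subspaces, as sets of representatives. *)
Definition findim_subspace (R : realType) (D : set (plane R))
    (X : set (H1fun R)) : Prop :=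
  exists (n : nat) (b : 'I_n -> H1fun R), (forall i, in_H10 D (b i)) /\
    X = [set x | in_H10 D x /\
           exists c : 'I_n -> R, normH10 D (x - \sum_(i < n) c i *: b i) = 0].

(** [H^{-1}(D)], the dual of [H^1_0(D)]. *)
Definition in_Hm1 (R : realType) (D : set (plane R)) (f : H1fun R -> R) : Prop :=
  (forall (a : R) (v w : H1fun R), in_H10 D v -> in_H10 D w ->
     f (a *: v + w) = a * f v + f w) /\
  exists C : R, forall v, in_H10 D v -> `|f v| <= C * normH10 D v.

(** Sequences of reals with the Borel sigma-algebra of the product topology; the
    parameter domain is the subset [Gam]. *)
Definition param (R : realType) : Type :=
  g_sigma_algebraType (@open {ptws nat -> R}).
HB.instance Definition _ (R : realType) := Measurable.on (param R).

Definition param_coord (R : realType) (y : param R) (m : nat) : R := (y : nat -> R) m.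

Definition Gam1 (R : realType) : set R := [set t | -1 <= t <= 1].
Definition Gam (R : realType) : set (param R) :=
  [set y | forall m, Gam1 (param_coord y m)].

(** The Borel probability measure [mu] is carried by [-1, 1] and has density [q]
    there. *)
Definition has_density (R : realType) (mu : probability (measurableTypeR R) R)
    (q : R -> R) : Prop :=
  [/\ measurable_fun (@Gam1 R : set (measurableTypeR R)) q,
      forall t, Gam1 t -> 0 <= q t &
    forall A : set (measurableTypeR R), measurable A ->
      mu A = (\int[lebesgue_measure]_(t in A `&` @Gam1 R) (q t)%:E)%E].

Definition is_product_measure (R : realType)
    (pim : nat -> probability (measurableTypeR R) R)
    (pi : probability (param R) R) : Prop :=
  forall (n : nat) (A : nat -> set (measurableTypeR R)), (forall m, measurable (A m)) ->
    pi [set y | forall m, (m < n)%N -> A m (param_coord y m)] =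
    (\prod_(m < n) pim m (A m))%E.

(** [v] is on [Gam] the pointwise limit, in the norm [N] of the space [S], of
    simple functions. *)
Definition strongly_measurable (R : realType) (E : lmodType R) (S : set E)
    (N : E -> R) (v : param R -> E) : Prop :=
  exists (k : nat -> nat) (A : nat -> nat -> set (param R)) (x : nat -> nat -> E),
    (forall n i, measurable (A n i) /\ S (x n i)) /\
    forall y, Gam y ->
      (fun n => N (v y - \sum_(i < k n) (\1_(A n i) y : R) *: x n i)) @ \oo
        --> (0 : R).

Definition in_Linf (R : realType) (D : set (plane R)) (g : plane R -> R^o) : Prop :=
  measurable_fun (D : set (mplane R)) (g : mplane R -> R) /\
  ('N[leb2 R]_(+oo)[EFin \o ((g : mplane R -> R) \_ D)] < +oo)%E.
Definition normLinf (R : realType) (D : set (plane R)) (g : plane R -> R^o) : R :=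
  fine ('N[leb2 R]_(+oo)[EFin \o ((g : mplane R -> R) \_ D)])%E.

(** [L^oo_pi(Gam; L^oo(D))]. *)
Definition bochner_Linf (R : realType) (D : set (plane R))
    (pi : probability (param R) R) (T : param R -> plane R -> R^o) : Prop :=
  [/\ forall y, Gam y -> in_Linf D (T y),
      strongly_measurable (in_Linf D) (normLinf D) T &
      exists M : R, {ae pi, forall y, Gam y -> normLinf D (T y) <= M}].

(** [V = L^2_pi(Gam; H^1_0(D))]; representatives denote the same element of [V]
    when [norm_bochner] of their difference vanishes. *)
Definition bochner_H10 (R : realType) (D : set (plane R))
    (pi : probability (param R) R) (v : param R -> H1fun R) : Prop :=
  [/\ forall y, Gam y -> in_H10 D (v y),
      strongly_measurable (in_H10 D) (normH10 D) v &
      pi.-integrable (@Gam R) (fun y => (normH10 D (v y) ^+ 2)%:E)].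

Definition norm_bochner (R : realType) (D : set (plane R))
    (pi : probability (param R) R) (v : param R -> H1fun R) : R :=
  Num.sqrt (\int[pi]_(y in @Gam R) (normH10 D (v y) ^+ 2)).

Definition diffusion_form (R : realType) (D : set (plane R))
    (pi : probability (param R) R) (T : param R -> plane R -> R^o)
    (u v : param R -> H1fun R) : R :=
  \int[pi]_(y in @Gam R) (\int[leb2 R]_(x in D)
    (T y x * (gradx (u y) x * gradx (v y) x + grady (u y) x * grady (v y) x))).

Definition load_functional (R : realType) (pi : probability (param R) R)
    (f : H1fun R -> R) (v : param R -> H1fun R) : R :=
  \int[pi]_(y in @Gam R) (f (v y)).

Definition sym_cont_elliptic_form (R : realType) (D : set (plane R))
    (pi : probability (param R) R)
    (b : (param R -> H1fun R) -> (param R -> H1fun R) -> R) : Prop :=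
  [/\ forall (a : R) (u v w : param R -> H1fun R),
        bochner_H10 D pi u -> bochner_H10 D pi v -> bochner_H10 D pi w ->
        b (a *: u + v) w = a * b u w + b v w,
      forall u v, bochner_H10 D pi u -> bochner_H10 D pi v -> b u v = b v u,
      exists C : R, forall u v, bochner_H10 D pi u -> bochner_H10 D pi v ->
        `|b u v| <= C * norm_bochner D pi u * norm_bochner D pi v &
      exists c : R, 0 < c /\
        forall v, bochner_H10 D pi v -> c * norm_bochner D pi v ^+ 2 <= b v v].

Definition energy_norm (R : realType) (W : Type) (b : W -> W -> R) (v : W) : R :=
  Num.sqrt (b v v).

Definition multi_index : Type := {fsfun nat -> nat with 0%N}.
HB.instance Definition _ := Choice.on multi_index.

Definition zero_index : multi_index := [fsfun].

Definition orthonormal_polys (R : realType) (mu : probability (measurableTypeR R) R)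
    (p : nat -> {poly R}) : Prop :=
  [/\ p 0%N = 1, forall n, size (p n) = n.+1 &
    forall n k, \int[mu]_(t in @Gam1 R) ((p n).[t] * (p k).[t]) = (n == k)%:R].

(** Since [p m 0 = 1], the infinite product reduces to the support of [a]. *)
Definition poly_alpha (R : realType) (p : nat -> nat -> {poly R})
    (a : multi_index) (y : param R) : R :=
  \prod_(m <- finsupp a) (p m (a m)).[param_coord y m].

Definition poly_span (R : realType) (p : nat -> nat -> {poly R})
    (I : {fset multi_index}) : set (param R -> R) :=
  [set psi | exists c : multi_index -> R,
     forall y, psi y = \sum_(a <- I) c a * poly_alpha p a y].

(** [X (x) P] inside [V]: the span of the products [x(.) psi(y)], up to equality in
    [V]. *)
Definition tensor_space (R : realType) (D : set (plane R))
    (pi : probability (param R) R) (X : set (H1fun R))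
    (P : set (param R -> R)) : set (param R -> H1fun R) :=
  [set v | bochner_H10 D pi v /\
     exists (n : nat) (x : 'I_n -> H1fun R) (psi : 'I_n -> param R -> R),
       (forall i, X (x i) /\ P (psi i)) /\
       norm_bochner D pi (v - (fun y => \sum_(i < n) psi i y *: x i)) = 0].

Definition sum_space (W : zmodType) (A B : set W) : set W :=
  [set w | exists u v, [/\ A u, B v & w = u + v]].

(* Main.v *)
Require Import Defs.
From HB Require Import structures.
From mathcomp Require Import all_boot all_order all_algebra finmap.
From mathcomp Require Import all_classical all_reals all_analysis.
From mathcomp Require Import measurable_realfun ess_sup_inf.
From mathcomp Require Import ring lra.

Set Implicit Arguments.
Unset Strict Implicit.
Unset Printing Implicit Defensive.

Import Order.TTheory GRing.Theory Num.Theory.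
Import numFieldNormedType.Exports.
Import HBSimple.

Local Open Scope classical_set_scope.
Local Open Scope ring_scope.

(** Write [e = u - uXP] for the error and [es = usXP - uXP] for its part seen by
    the enriched space. Everything rests on evaluating the residual
    [v |-> F v - B uXP v = B e v].

    Lower bound. Testing the two local problems with their own solutions gives
    [eta ^+ 2 = B e (eYP + eXQ)]. Cauchy-Schwarz for [B], the norm equivalence, and
    [||eYP + eXQ|| <= sqrt 2 * eta] in the auxiliary norm finish
    ([estimator_lower]); when the two corrections are orthogonal the factor
    [sqrt 2] disappears.

    Upper bound. Decompose [es = wX + wY + wQ] along the three discrete spaces.
    Galerkin orthogonality kills [wX], so [B es es = Bt eYP wY + Bt eXQ wQ], which is
    at most [eta] times the root of [||wY||^2 + ||wQ||^2]. The strengthened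
    Cauchy-Schwarz inequalities bound this last sum by [||es||^2], up to the factor
    [(1 - k1) * (1 - k2 ^+ 2)] ([split_norm], [estimator_upper_enhanced]). Saturation
    and Pythagoras pass from [es] to [e] ([saturation_enhanced]). Using the components
    of [es] directly, no auxiliary problem on the enriched space has to be solved.

    This argument is carried out for an arbitrary pair of positive semidefinite
    symmetric forms on a subspace of a module. The remaining work is to show that the
    Bochner space and the forms at hand fit that frame.
    - [V] is closed under linear combinations ([bochner_subspace]), which requires
      the same of [H^1_0(D)] ([in_H10_subspace]) and of strong measurability.
    - [B] is bilinear on [V]: the integrand over the parameter domain has to be
      measurable and integrable. Measurability follows by freezing the slots of the
      trilinear form [int_D t grad v . grad w] one at a time
      ([measurable_strongly_measurable]).
    - [B] is nonnegative on [V] ([diffusion_semi_inner]): where the norm of [v] is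
      positive, ellipticity of the auxiliary form and the norm equivalence force
      [B v v > 0]; where it vanishes, boundedness of the coefficient gives
      [B v v = 0].
    - The tensor spaces are closed under subtraction ([tensor_spaceB]), because
      polynomials are measurable and bounded on the parameter domain, so that the
      representing sums lie in [V]. *)

(** * Linear forms and semidefinite inner products on a subspace *)

(** The function spaces below are sets of representatives inside a larger module
    of functions, on which integrals need not be additive. Hence all linear notions
    are relative to a subset, and inner products are only semidefinite, a nonzero
    representative of the zero class having norm zero. *)
Definition vector_subspace (R : realType) (E : lmodType R) (S : set E) : Prop :=
  S 0 /\ forall (a : R) u v, S u -> S v -> S (a *: u + v).

Definition linear_on (R : realType) (E : lmodType R) (S : set E) (l : E -> R) :
    Prop :=
  forall (a : R) u v, S u -> S v -> l (a *: u + v) = a * l u + l v.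

Definition semi_inner (R : realType) (E : lmodType R) (S : set E)
    (b : E -> E -> R) : Prop :=
  [/\ forall w, S w -> linear_on S (b^~ w),
      forall u v, S u -> S v -> b u v = b v u &
      forall v, S v -> 0 <= b v v].

Section vector_subspace.
Variables (R : realType) (E : lmodType R) (S : set E).
Hypothesis hS : vector_subspace S.

Lemma subspace0 : S 0. Proof. by case: hS. Qed.

Lemma subspaceZ (a : R) u : S u -> S (a *: u).
Proof. by move=> Su; rewrite -[_ *: _]addr0; apply: (hS.2) => //; apply: hS.1. Qed.

Lemma subspaceD u v : S u -> S v -> S (u + v).
Proof. by move=> Su Sv; rewrite -[u]scale1r; apply: (hS.2). Qed.

Lemma subspaceB u v : S u -> S v -> S (u - v).
Proof. by move=> Su Sv; rewrite addrC -scaleN1r; apply: (hS.2). Qed.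

Lemma subspace_sum (n : nat) (c : 'I_n -> R) (x : 'I_n -> E) :
  (forall i, S (x i)) -> S (\sum_(i < n) c i *: x i).
Proof.
by move=> Sx; elim/big_ind: _ => [|u v|i _];
  [exact: subspace0|exact: subspaceD|exact: subspaceZ].
Qed.

Section linear_form.
Variable l : E -> R.
Hypothesis hl : linear_on S l.

Lemma linear_on0 : l 0 = 0.
Proof.
have := hl 1 subspace0 subspace0; rewrite scale1r addr0 mul1r => h.
by apply: (addrI (l 0)); rewrite addr0 -h.
Qed.

Lemma linear_onZ (a : R) u : S u -> l (a *: u) = a * l u.
Proof.
move=> Su; have := hl a Su subspace0.
by rewrite !addr0 linear_on0 addr0.
Qed.

Lemma linear_onD u v : S u -> S v -> l (u + v) = l u + l v.
Proof. by move=> Su Sv; rewrite -[in LHS](scale1r u) hl// mul1r. Qed.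

Lemma linear_onB u v : S u -> S v -> l (u - v) = l u - l v.
Proof. by move=> Su Sv; rewrite addrC -scaleN1r hl// mulN1r addrC. Qed.

Lemma linear_on_sum (n : nat) (c : 'I_n -> R) (x : 'I_n -> E) :
  (forall i, S (x i)) ->
  l (\sum_(i < n) c i *: x i) = \sum_(i < n) c i * l (x i).
Proof.
elim: n c x => [|n IH] c x Sx; first by rewrite !big_ord0 linear_on0.
rewrite !big_ord_recr /= linear_onD; last 2 first.
- by apply: subspace_sum.
- exact: subspaceZ.
by rewrite IH// linear_onZ.
Qed.

(** A linear form that is bounded on the unit ball of a seminorm is bounded by it:
    scale [x] to norm one, or, when [N x = 0], by an arbitrarily large factor. *)
Lemma linear_on_bounded (N : E -> R) (K : R) :
  (forall x, S x -> 0 <= N x) ->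
  (forall (a : R) x, S x -> N (a *: x) = `|a| * N x) ->
  (forall x, S x -> `|l x| <= K * (N x ^+ 2 + 1)) ->
  forall x, S x -> `|l x| <= 2 * K * N x.
Proof.
move=> N0 NZ lK x Sx.
have hs (s : R) : 0 < s -> s * `|l x| <= K * (s ^+ 2 * N x ^+ 2 + 1).
  move=> s0; have := lK _ (subspaceZ s Sx).
  by rewrite linear_onZ// NZ// normrM (gtr0_norm s0) exprMn.
have := N0 x Sx; rewrite le_eqVlt => /orP[/eqP Nx0|Nx0].
  rewrite -Nx0 mulr0 leNgt; apply/negP => lx0.
  have K0 : 0 <= K.
    by have := hs 1 ltr01; rewrite -Nx0 expr0n mulr0 add0r; nra.
  have s0 : 0 < (K + 1) / `|l x| by rewrite divr_gt0// ltr_wpDl.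
  have := hs _ s0; rewrite -Nx0 expr0n mulr0 add0r mulr1 divfK ?gt_eqF//.
  lra.
have s0 : 0 < (N x)^-1 by rewrite invr_gt0.
have := hs _ s0; rewrite -exprMn mulVf ?gt_eqF// expr1n.
by rewrite mulrC ler_pdivrMr// (_ : 1 + 1 = 2)// (mulrC K).
Qed.

End linear_form.
End vector_subspace.

Section semi_inner_theory.
Variables (R : realType) (E : lmodType R) (S : set E) (b : E -> E -> R).
Hypotheses (hS : vector_subspace S) (hb : semi_inner S b).
Let n := energy_norm b.

Lemma semi_inner_linl w : S w -> linear_on S (b^~ w).
Proof. by case: hb => h _ _; exact: h. Qed.

Lemma semi_inner_sym u v : S u -> S v -> b u v = b v u.
Proof. by case: hb => _ h _; exact: h. Qed.

Lemma semi_inner_linr w : S w -> linear_on S (b w).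
Proof.
move=> Sw a u v Su Sv.
rewrite !(semi_inner_sym Sw)//; last exact: hS.2.
exact: (semi_inner_linl Sw).
Qed.

Lemma semi_inner_ge0 v : S v -> 0 <= b v v.
Proof. by case: hb => _ _ h; exact: h. Qed.

Lemma energy_norm_ge0 v : 0 <= n v. Proof. exact: sqrtr_ge0. Qed.

Lemma energy_norm_sqr v : S v -> n v ^+ 2 = b v v.
Proof. by move=> Sv; rewrite sqr_sqrtr// semi_inner_ge0. Qed.

(** All inequalities between energy norms below come from expanding a square. *)
Lemma semi_innerZD (a c : R) u v : S u -> S v ->
  b (a *: u + c *: v) (a *: u + c *: v) =
  a ^+ 2 * b u u + 2 * (a * c) * b u v + c ^+ 2 * b v v.
Proof.
move=> Su Sv; have Sau := subspaceZ hS a Su; have Scv := subspaceZ hS c Sv.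
have Sw := subspaceD hS Sau Scv.
have lu := semi_inner_linr Su; have lv := semi_inner_linr Sv.
rewrite (linear_onD (semi_inner_linl Sw))//.
rewrite !(linear_onZ hS (semi_inner_linl Sw))//.
rewrite (linear_onD lu)// (linear_onD lv)// !(linear_onZ hS lu)//.
rewrite !(linear_onZ hS lv)// (semi_inner_sym Sv Su).
ring.
Qed.

Lemma Cauchy_Schwarz u v : S u -> S v -> `|b u v| <= n u * n v.
Proof.
move=> Su Sv; rewrite -sqrtrM ?semi_inner_ge0// -sqrtr_sqr ler_wsqrtr//.
have u0 := semi_inner_ge0 Su; have v0 := semi_inner_ge0 Sv.
have h a c : 0 <= a ^+ 2 * b u u + 2 * (a * c) * b u v + c ^+ 2 * b v v.
  rewrite -semi_innerZD//.
  exact: semi_inner_ge0 (subspaceD hS (subspaceZ hS a Su) (subspaceZ hS c Sv)).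
(* Among the vectors [a *: u - b u u *: v], the one of least square. *)
have h1 := h (b u v) (- b u u).
have [u00|un0] := eqVneq (b u u) 0.
  (* The form is now affine in the coefficient of [u], hence constant in it. *)
  have [->|x0] := eqVneq (b u v) 0; first by rewrite u00 expr0n mul0r.
  have := h (- (b v v + 1) / b u v) 1.
  rewrite u00 !mulr0 add0r !mulr1 expr1n mul1r -mulrA divfK//; lra.
have : 0 < b u u by rewrite lt0r un0.
nra.
Qed.

Lemma energy_normD u v : S u -> S v -> n (u + v) <= n u + n v.
Proof.
move=> Su Sv.
rewrite -(ler_pXn2r (_ : 0 < 2)%N)// ?nnegrE ?addr_ge0 ?energy_norm_ge0//.
rewrite energy_norm_sqr; last exact: subspaceD.
rewrite -[u]scale1r -[v]scale1r semi_innerZD// !scale1r.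
have := Cauchy_Schwarz Su Sv; rewrite ler_norml => /andP[_].
rewrite sqrrD !energy_norm_sqr//; nra.
Qed.

Lemma energy_normZ (a : R) u : S u -> n (a *: u) = `|a| * n u.
Proof.
move=> Su; have Sau := subspaceZ hS a Su.
rewrite /n /energy_norm (linear_onZ hS (semi_inner_linl Sau))//.
rewrite (linear_onZ hS (semi_inner_linr Su))// mulrA -expr2.
by rewrite sqrtrM ?sqr_ge0// sqrtr_sqr.
Qed.

End semi_inner_theory.

(** * The error estimator in an abstract energy space *)

Section abstract_estimator.
Variables (R : realType) (E : lmodType R) (V : set E) (B Bt : E -> E -> R).
Hypotheses (hV : vector_subspace V) (hB : semi_inner V B) (hBt : semi_inner V Bt).
Variables (F : E -> R) (XP YP XQ : set E).
Hypotheses (XPV : XP `<=` V) (YPV : YP `<=` V) (XQV : XQ `<=` V).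
Hypotheses (XP0 : XP 0) (XPB : forall v w, XP v -> XP w -> XP (v - w)).
Let nB := energy_norm B.
Let nBt := energy_norm Bt.
Let XsP := sum_space XP YP.
Let VsXP := sum_space XsP XQ.
Variables (u uXP usXP : E).
Hypotheses (hu : V u) (hu_eq : forall v, V v -> B u v = F v).
Hypotheses (huXP : XP uXP) (huXP_eq : forall v, XP v -> B uXP v = F v).
Variables (lam Lam : R).
Hypotheses (hlam : 0 < lam) (hLam : 0 < Lam).
Hypothesis hequiv : forall v, V v -> lam * nB v <= nBt v <= Lam * nB v.
Variables (eYP eXQ : E).
Hypotheses (heYP : YP eYP)
  (heYP_eq : forall v, YP v -> Bt eYP v = F v - B uXP v).
Hypotheses (heXQ : XQ eXQ)
  (heXQ_eq : forall v, XQ v -> Bt eXQ v = F v - B uXP v).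
Let eta := Num.sqrt (nBt eYP ^+ 2 + nBt eXQ ^+ 2).
Let e := u - uXP.

Let Ve : V e. Proof. by apply: subspaceB => //; exact: XPV. Qed.

Lemma residual v : V v -> F v - B uXP v = B e v.
Proof.
move=> Vv; rewrite -hu_eq// (linear_onB (semi_inner_linl hB Vv))//.
exact: XPV.
Qed.

Lemma estimator_ge0 : 0 <= eta. Proof. exact: sqrtr_ge0. Qed.

Lemma estimator_sqr : eta ^+ 2 = nBt eYP ^+ 2 + nBt eXQ ^+ 2.
Proof. by rewrite sqr_sqrtr// addr_ge0 ?sqr_ge0. Qed.

(** Each local problem is tested with its own solution. *)
Lemma estimator_residual : eta ^+ 2 = B e (eYP + eXQ).
Proof.
have VY := YPV heYP; have VQ := XQV heXQ.
rewrite estimator_sqr !(energy_norm_sqr hBt)// heYP_eq// heXQ_eq// !residual//.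
by rewrite (linear_onD (semi_inner_linr hV hB Ve)).
Qed.

(** The constant [K] measures how far [eYP] and [eXQ] are from being orthogonal. *)
Lemma estimator_lower (K : R) : 0 < K -> nBt (eYP + eXQ) <= K * eta ->
  lam / K * eta <= nB e.
Proof.
move=> K0 hK; have VY := YPV heYP; have VQ := XQV heXQ.
have VYQ := subspaceD hV VY VQ.
have eB0 : 0 <= nB e by exact: energy_norm_ge0.
have := Cauchy_Schwarz hV hB Ve VYQ.
rewrite -estimator_residual ger0_norm ?sqr_ge0// -!/nB => h.
have /andP[l1 _] := hequiv VYQ.
have h2 : lam * eta ^+ 2 <= nB e * (K * eta).
  apply: le_trans (_ : nB e * (lam * nB (eYP + eXQ)) <= _).
    by rewrite [leRHS]mulrCA ler_pM2l.
  by rewrite ler_wpM2l// (le_trans l1).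
have := estimator_ge0; rewrite le_eqVlt => /orP[/eqP<-|eta0].
  by rewrite mulr0.
rewrite mulrAC ler_pdivrMr// -(ler_pM2r eta0).
by rewrite -mulrA -expr2 -[leRHS]mulrA.
Qed.

Lemma estimator_lower_sqrt2 : lam / Num.sqrt 2 * eta <= nB e.
Proof.
have VY := YPV heYP; have VQ := XQV heXQ.
apply: estimator_lower; first by rewrite sqrtr_gt0.
rewrite -(ler_pXn2r (_ : 0 < 2)%N)// ?nnegrE ?mulr_ge0 ?sqrtr_ge0//.
rewrite exprMn estimator_sqr (sqr_sqrtr (ler0n R 2)).
apply: le_trans (_ : (nBt eYP + nBt eXQ) ^+ 2 <= _); last first.
  by have := sqr_ge0 (nBt eYP - nBt eXQ); rewrite sqrrB sqrrD; lra.
rewrite ler_pXn2r// ?nnegrE ?addr_ge0 ?sqrtr_ge0//.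
exact: (energy_normD hV hBt).
Qed.

(** Orthogonality is used through the pair [eYP], [eXQ], where [eYP = 0 + eYP] lies
    in the sum of the first two spaces. *)
Lemma estimator_lower_orth :
  (forall w v, XsP w -> XQ v -> `|Bt w v| <= 0) -> lam * eta <= nB e.
Proof.
move=> orth; have VY := YPV heYP; have VQ := XQV heXQ.
rewrite -[lam]divr1; apply: estimator_lower => //; rewrite mul1r.
rewrite -(ler_pXn2r (_ : 0 < 2)%N)// ?nnegrE ?sqrtr_ge0//.
have /eqP : `|Bt eYP eXQ| == 0.
  rewrite eq_le normr_ge0 andbT orth//.
  by exists 0, eYP; split => //; rewrite add0r.
move/normr0P/eqP => o.
rewrite estimator_sqr !(energy_norm_sqr hBt)//; last exact: subspaceD.
rewrite -[eYP]scale1r -[eXQ]scale1r (semi_innerZD hV hBt)// !scale1r o.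
lra.
Qed.

Variable k1 k2 : R.
Hypotheses (hk1 : 0 <= k1 < 1) (hk2 : 0 <= k2 < 1).
Hypothesis hCS1 : forall w v, XsP w -> XQ v -> `|Bt w v| <= k1 * nBt w * nBt v.
Hypothesis hCS2 : forall w v, XP w -> YP v -> `|Bt w v| <= k2 * nBt w * nBt v.

(** The strengthened Cauchy--Schwarz inequalities bound the angles between the
    three components of a discrete function away from zero, so that the
    components cannot cancel. *)
Lemma split_norm wX wY wQ : XP wX -> YP wY -> XQ wQ ->
  (1 - k1) * (1 - k2 ^+ 2) * (nBt wY ^+ 2 + nBt wQ ^+ 2) <=
  nBt (wX + wY + wQ) ^+ 2.
Proof.
move=> hX hY hQ; have VX := XPV hX; have VY := YPV hY; have VQ := XQV hQ.
have VXY := subspaceD hV VX VY; have VXYQ := subspaceD hV VXY VQ.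
move: hk1 hk2 => /andP[k10 k11] /andP[k20 k21].
have hXY : (1 - k2 ^+ 2) * nBt wY ^+ 2 <= nBt (wX + wY) ^+ 2.
  have := hCS2 hX hY; rewrite ler_norml => /andP[h _].
  rewrite [leRHS](energy_norm_sqr hBt)// -[wX in leRHS]scale1r.
  rewrite -[wY in leRHS]scale1r (semi_innerZD hV hBt)//.
  rewrite -(energy_norm_sqr hBt VX) -(energy_norm_sqr hBt VY) -/nBt.
  have := sqr_ge0 (nBt wX - k2 * nBt wY); nra.
have XsPXY : XsP (wX + wY) by exists wX, wY.
have := hCS1 XsPXY hQ; rewrite ler_norml => /andP[h _].
rewrite [leRHS](energy_norm_sqr hBt)//.
have -> : Bt (wX + wY + wQ) (wX + wY + wQ) =
    nBt (wX + wY) ^+ 2 + 2 * Bt (wX + wY) wQ + nBt wQ ^+ 2.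
  rewrite -[X in X + wQ]scale1r -[wQ in LHS]scale1r (semi_innerZD hV hBt)//.
  by rewrite !(energy_norm_sqr hBt)//; ring.
have h2 : k2 ^+ 2 <= 1 by rewrite expr_le1// ltW.
have h3 := sqr_ge0 (nBt (wX + wY) - nBt wQ).
have h4 : (1 - k1) * (nBt (wX + wY) ^+ 2 + nBt wQ ^+ 2) <=
    nBt (wX + wY) ^+ 2 + 2 * Bt (wX + wY) wQ + nBt wQ ^+ 2 by nra.
apply: le_trans h4; rewrite -mulrA ler_wpM2l ?subr_ge0 ?(ltW k11)//.
rewrite mulrDr; apply: lerD => //.
have := sqr_ge0 (nBt wQ); have := sqr_ge0 k2; nra.
Qed.

Hypotheses (husXP : VsXP usXP) (husXP_eq : forall v, VsXP v -> B usXP v = F v).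
Let es := usXP - uXP.

(** Only the [wY] and [wQ] components of [es] meet the residual, and [split_norm]
    controls them by [es] itself. *)
Lemma estimator_upper_enhanced :
  nB es <= Lam / Num.sqrt ((1 - k1) * (1 - k2 ^+ 2)) * eta.
Proof.
move: hk1 hk2 => /andP[k10 k11] /andP[k20 k21].
have h2 : k2 ^+ 2 < 1 by rewrite expr_lt1.
have [wXY [wQ [[wX [wY [hX hY eXY]]] hQ eusXP]]] := husXP.
have VX := XPV hX; have VY := YPV hY; have VQ := XQV hQ.
have hX' := XPB hX huXP; have VX' := XPV hX'.
have es_split : es = (wX - uXP) + wY + wQ.
  by rewrite /es eusXP eXY (addrAC _ wQ) (addrAC _ wY).
have Ves : V es.
  by rewrite es_split; apply: subspaceD => //; apply: subspaceD.
have le := semi_inner_linr hV hB Ve.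
have VXY := subspaceD hV VX' VY.
have galerkin : B e (wX - uXP) = 0.
  by rewrite -residual// huXP_eq// subrr.
have VsXYQ v : XsP v -> V v.
  by move=> [a [b [ha hb ->]]]; apply: subspaceD => //; [exact: XPV|exact: YPV].
have es2 : nB es ^+ 2 = Bt eYP wY + Bt eXQ wQ.
  have VusXP : V usXP by rewrite eusXP; apply: subspaceD => //; rewrite eXY;
     apply: subspaceD.
  rewrite (energy_norm_sqr hB)// heYP_eq// heXQ_eq// !residual//.
  have -> : B es es = B e es.
    rewrite (linear_onB (semi_inner_linl hB Ves))//; last exact: XPV.
    rewrite [RHS](linear_onB (semi_inner_linl hB Ves))//; last exact: XPV.
    rewrite hu_eq// husXP_eq//.
    by exists (wX - uXP + wY), wQ; split => //; exists (wX - uXP), wY.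
  by rewrite es_split (linear_onD le)// (linear_onD le)// galerkin add0r.
set r := Num.sqrt ((1 - k1) * (1 - k2 ^+ 2)).
have r0 : 0 < r by rewrite sqrtr_gt0 mulr_gt0// subr_gt0.
set s := Num.sqrt (nBt wY ^+ 2 + nBt wQ ^+ 2).
have s0 : 0 <= s by exact: sqrtr_ge0.
have r2 : r ^+ 2 = (1 - k1) * (1 - k2 ^+ 2).
  by rewrite sqr_sqrtr// mulr_ge0// subr_ge0 ltW.
have s2 : s ^+ 2 = nBt wY ^+ 2 + nBt wQ ^+ 2.
  by rewrite sqr_sqrtr// addr_ge0 ?sqr_ge0.
have rs : r * s <= nBt es.
  rewrite -(ler_pXn2r (_ : 0 < 2)%N)// ?nnegrE ?mulr_ge0 ?sqrtr_ge0//.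
  by rewrite exprMn r2 s2 es_split split_norm.
have bnd : nB es ^+ 2 <= eta * s.
  rewrite es2; apply: le_trans (ler_norm _) _.
  apply: le_trans (ler_normD _ _) _.
  apply: le_trans (_ : nBt eYP * nBt wY + nBt eXQ * nBt wQ <= _).
    by apply: lerD; apply: (Cauchy_Schwarz hV hBt) => //; [exact: YPV|exact: XQV].
  rewrite -(ler_pXn2r (_ : 0 < 2)%N)// ?nnegrE.
  - rewrite exprMn estimator_sqr s2.
    have := sqr_ge0 (nBt eYP * nBt wQ - nBt eXQ * nBt wY); lra.
  - by rewrite addr_ge0// mulr_ge0 ?energy_norm_ge0.
  - exact: mulr_ge0 estimator_ge0 s0.
have /andP[_ hL] := hequiv Ves.
have es0 : 0 <= nB es by exact: energy_norm_ge0.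
have eta0 := estimator_ge0.
rewrite mulrAC ler_pdivlMr//.
move: es0; rewrite le_eqVlt => /orP[/eqP<-|es0].
  by rewrite mul0r mulr_ge0// ltW.
rewrite -(ler_pM2r es0).
apply: le_trans (_ : eta * (r * s) <= _).
  by rewrite mulrAC -expr2 mulrC [leRHS]mulrCA ler_wpM2l// ltW.
apply: le_trans (_ : eta * (Lam * nB es) <= _).
  by rewrite ler_wpM2l// (le_trans rs).
by rewrite mulrA (mulrC eta).
Qed.

Variable beta : R.
Hypotheses (hbeta : 0 <= beta < 1) (hsat : nB (u - usXP) <= beta * nB e).

(** Galerkin orthogonality gives [nB e ^+ 2 = nB (u - usXP) ^+ 2 + nB es ^+ 2];
    saturation then makes [es] carry a fixed fraction of the error. *)
Lemma saturation_enhanced : nB e <= (Num.sqrt (1 - beta ^+ 2))^-1 * nB es.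
Proof.
move: hbeta => /andP[b0 b1].
have bb : beta ^+ 2 < 1 by rewrite expr_lt1.
have [wXY [wQ [[wX [wY [hX hY eXY]]] hQ eusXP]]] := husXP.
have VX := XPV hX; have VY := YPV hY; have VQ := XQV hQ; have VuXP := XPV huXP.
have VusXP : V usXP.
  by rewrite eusXP; apply: subspaceD => //; rewrite eXY; apply: subspaceD.
have VsXPes : VsXP es.
  exists (wX - uXP + wY), wQ; split => //.
    by exists (wX - uXP), wY; split => //; exact: XPB.
  by rewrite /es eusXP eXY (addrAC _ wQ) (addrAC _ wY).
have Ves : V es by exact: subspaceB.
have Vd : V (u - usXP) by exact: subspaceB.
have pyth : nB e ^+ 2 = nB (u - usXP) ^+ 2 + nB es ^+ 2.
  have -> : e = 1 *: (u - usXP) + 1 *: es by rewrite !scale1r addrA subrK.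
  rewrite !(energy_norm_sqr hB)//; last by apply: subspaceD => //; exact: subspaceZ.
  rewrite (semi_innerZD hV hB)// (linear_onB (semi_inner_linl hB Ves))//.
  by rewrite hu_eq// husXP_eq// subrr !expr1n !mul1r !mulr0 addr0.
have d0 : 0 <= nB (u - usXP) by exact: energy_norm_ge0.
have e0 : 0 <= nB e by exact: energy_norm_ge0.
have r0 : 0 < Num.sqrt (1 - beta ^+ 2) by rewrite sqrtr_gt0 subr_gt0.
rewrite mulrC ler_pdivlMr// -(ler_pXn2r (_ : 0 < 2)%N)//; last 2 first.
- by rewrite nnegrE mulr_ge0// sqrtr_ge0.
- by rewrite nnegrE energy_norm_ge0.
have b2 : 0 <= 1 - beta ^+ 2 by rewrite subr_ge0 ltW.
rewrite exprMn (sqr_sqrtr b2).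
have := ler_pM d0 d0 hsat hsat; rewrite -!expr2 exprMn; lra.
Qed.

Lemma estimator_upper : nB e <=
  Lam / (Num.sqrt (1 - beta ^+ 2) * Num.sqrt ((1 - k1) * (1 - k2 ^+ 2))) * eta.
Proof.
apply: le_trans saturation_enhanced _.
rewrite invfM mulrCA -mulrA ler_wpM2l ?invr_ge0 ?sqrtr_ge0//.
exact: estimator_upper_enhanced.
Qed.

End abstract_estimator.

(** * Integrability and square-integrability *)

Section square_integrable.
Context d (T : measurableType d) (R : realType) (mu : {measure set T -> \bar R}).
Variables (D : set T) (mD : measurable D).

Lemma integrable_dominated (f g : T -> R) : measurable_fun D f ->
  (forall x, D x -> `|f x| <= g x) -> mu.-integrable D (EFin \o g) ->
  mu.-integrable D (EFin \o f).
Proof.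
move=> mf fg; apply: le_integrable => //; first exact/measurable_EFinP.
move=> x Dx /=; rewrite lee_fin; apply: le_trans (fg x Dx) _.
exact: ler_norm.
Qed.

Definition square_integrable (f : T -> R) : Prop :=
  measurable_fun D f /\ mu.-integrable D (fun x => (f x ^+ 2)%:E).

(** Since [2 |f g| <= f ^+ 2 + g ^+ 2]. *)
Lemma square_integrableM (f g : T -> R) :
  square_integrable f -> square_integrable g ->
  mu.-integrable D (EFin \o (fun x => f x * g x)).
Proof.
move=> [mf sf] [mg sg].
apply: (@integrable_dominated _ (fun x => f x ^+ 2 + g x ^+ 2)).
- exact: measurable_funM.
- move=> x _; rewrite normrM.
  have := sqr_ge0 (`|f x| - `|g x|); have := sqr_ge0 (f x).
  have := sqr_ge0 (g x); rewrite -(real_normK (num_real (f x))).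
  rewrite -(real_normK (num_real (g x))); nra.
- under [_ \o _]eq_fun do rewrite /= EFinD.
  exact: integrableD.
Qed.

Lemma square_integrable_lin (a : R) (f g : T -> R) :
  square_integrable f -> square_integrable g ->
  square_integrable (fun x => a * f x + g x).
Proof.
move=> [mf sf] [mg sg].
have mh : measurable_fun D (fun x => a * f x + g x).
  by apply: measurable_funD => //; exact: measurable_funM.
split => //.
apply: (@integrable_dominated _ (fun x => (2 * a ^+ 2) * f x ^+ 2 + 2 * g x ^+ 2)).
- exact: measurable_funX.
- move=> x _; rewrite ger0_norm ?sqr_ge0//.
  have := sqr_ge0 (a * f x - g x); nra.
- under [_ \o _]eq_fun do rewrite /= EFinD !(EFinM _ (_ ^+ 2)).
  by apply: integrableD => //; apply: integrableZl.
Qed.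

Lemma square_integrable_bounded (f : T -> R) (M : R) : measurable_fun D f ->
  (mu D < +oo)%E -> (forall x, D x -> `|f x| <= M) -> square_integrable f.
Proof.
move=> mf muD fM; split => //.
apply: (@integrable_dominated _ (cst (M ^+ 2))).
- exact: measurable_funX.
- move=> x Dx; rewrite ger0_norm ?sqr_ge0// -(real_normK (num_real (f x))).
  by rewrite lerXn2r ?nnegrE// ?fM// (le_trans _ (fM x Dx)).
- apply/integrableP; split; first exact/measurable_EFinP.
  rewrite (_ : \int[mu]_(x in D) _ = `|(M ^+ 2)%:E| * mu D)%E; last first.
    by rewrite -integral_cst.
  by rewrite abse_EFin lte_mul_pinfty// lee_fin.
Qed.

End square_integrable.

Section ae_dominated.
Context d (T : measurableType d) (R : realType) (mu : {measure set T -> \bar R}).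
Variables (D : set T) (mD : measurable D).

(** The coefficient is controlled almost everywhere only, so domination is needed
    in this form; it yields the bound on the integral at the same time. *)
Lemma integrable_ae_dominated (f g : T -> R) : measurable_fun D f ->
  mu.-integrable D (EFin \o g) -> (forall x, D x -> 0 <= g x) ->
  {ae mu, forall x, D x -> `|f x| <= g x} ->
  mu.-integrable D (EFin \o f) /\
  `|\int[mu]_(x in D) f x| <= \int[mu]_(x in D) g x.
Proof.
move=> mf ig g0 fg; have [mg goo] := integrableP _ _ _ ig.
have le_fg : (\int[mu]_(x in D) `|(EFin \o f) x| <=
    \int[mu]_(x in D) `|(EFin \o g) x|)%E.
  apply: ae_ge0_le_integral => //.
  - by apply/measurableT_comp => //; exact/measurable_EFinP.
  - by apply/measurableT_comp.
  - apply: filterS fg => x fg Dx /=; rewrite lee_fin.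
    by apply: le_trans (fg Dx) (ler_norm _).
have intf : mu.-integrable D (EFin \o f).
  by apply/integrableP; split; [exact/measurable_EFinP|exact: le_lt_trans goo].
split => //; rewrite -lee_fin EFin_normr_Rintegral//.
apply: le_trans (le_abse_integral _ mD _) _; first by case/integrableP: intf.
apply: le_trans le_fg _; rewrite /Rintegral fineK; last exact: integrable_fin_num.
by rewrite le_eqVlt; apply/orP; left; apply/eqP/eq_integral => x;
  rewrite inE => Dx; rewrite /= ger0_norm// g0.
Qed.

End ae_dominated.

Section Rintegral_lin.
Context d (T : measurableType d) (R : realType) (mu : {measure set T -> \bar R}).
Variables (D : set T) (mD : measurable D).

Lemma integrable_lin (a : R) (f g : T -> R) :
  mu.-integrable D (EFin \o f) -> mu.-integrable D (EFin \o g) ->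
  mu.-integrable D (EFin \o (fun x => a * f x + g x)).
Proof.
move=> intf intg; rewrite (_ : _ \o _ =
    (fun x => a%:E * (EFin \o f) x + (EFin \o g) x)%E).
  by apply: integrableD => //; exact: integrableZl.
by apply/funext => x; rewrite /= EFinD EFinM.
Qed.

Lemma Rintegral_lin (a : R) (f g : T -> R) :
  mu.-integrable D (EFin \o f) -> mu.-integrable D (EFin \o g) ->
  \int[mu]_(x in D) (a * f x + g x) =
  a * \int[mu]_(x in D) f x + \int[mu]_(x in D) g x.
Proof.
move=> intf intg; rewrite RintegralD ?RintegralZl//.
rewrite (_ : _ \o _ = (fun x => a%:E * (EFin \o f) x)%E); first exact: integrableZl.
by apply/funext => x; rewrite /= EFinM.
Qed.

End Rintegral_lin.

(** * Borel sets of the plane *)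

Section plane.
Variable R : realType.

(** Second countability: an open set is the union of the squares with rational
    centre and side [2 / n.+1] that it contains. *)
Lemma open_measurable_plane (A : set (plane R)) :
  open A -> measurable (A : set (mplane R)).
Proof.
move=> oA.
pose box (i : rat * rat * nat) : set (mplane R) :=
  ball (ratr i.1.1 : R) (i.2.+1%:R^-1) `*` ball (ratr i.1.2 : R) (i.2.+1%:R^-1).
pose F i : set (mplane R) := if `[< box i `<=` A >] then box i else set0.
rewrite [X in measurable X](_ : _ = \bigcup_i F i).
  apply: countable_bigcupT_measurable => // i; rewrite /F.
  case: asboolP => // _; apply: measurableX; exact: measurable_ball.
apply/seteqP; split => [[x1 x2] Ax|x [i _]]; last first.
  by rewrite /F; case: asboolP => // h; exact: h.
have : nbhs (x1, x2) A by exact: open_nbhs_nbhs.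
case=> -[U1 U2] /= [/nbhs_ballP[e1 /= e10 b1] /nbhs_ballP[e2 /= e20 b2]] UA.
pose e := Num.min e1 e2.
have e0 : 0 < e by rewrite lt_min e10.
pose n := Num.truncn (2 / e).
have nP : 2 / e < n.+1%:R by exact: truncnS_gt.
have n0 : 0 < n.+1%:R^-1 :> R by rewrite invr_gt0.
have ne : n.+1%:R^-1 *+ 2 < e.
  by rewrite -[_ *+ 2]mulr_natl ltr_pdivrMr// mulrC -ltr_pdivrMr.
set c : R := n.+1%:R^-1 in n0 ne.
have rat_near (x : R) : exists q : rat, `|x - ratr q| < c.
  have := @rat_in_itvoo R (x - c) (x + c).
  case; first by lra.
  by move=> q; rewrite in_itv/= => /andP[h1 h2]; exists q; rewrite ltr_distlC;
     apply/andP; split; lra.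
have [q1 hq1] := rat_near x1; have [q2 hq2] := rat_near x2.
have near_ball (x y q : R) (e' : R) : e <= e' -> `|x - q| < c ->
    `|q - y| < c -> ball x e' y.
  move=> ee' h1 h2; rewrite /ball/=; have := ler_distD q x y.
  move: ne; lra.
exists (q1, q2, n) => //; rewrite /F ifT; first by split; rewrite /ball/= distrC.
apply/asboolP => -[y1 y2] [/= h1 h2]; apply: UA; split => /=.
- by apply: b1; apply: near_ball hq1 h1; rewrite ge_min lexx.
- by apply: b2; apply: near_ball hq2 h2; rewrite ge_min lexx orbT.
Qed.

Lemma continuous_measurable_plane (f : plane R -> R^o) :
  continuous f -> measurable_fun setT (f : mplane R -> R).
Proof.
move=> /continuousP cf; apply: (measurability _ (RGenOpens.measurableE R)).
move=> _ [_ [a [b ->] <-]]; rewrite setTI; apply: open_measurable_plane.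
exact/cf/interval_open.
Qed.

Lemma bounded_leb2_finite (D : set (plane R)) :
  bounded_set D -> measurable (D : set (mplane R)) -> (leb2 R D < +oo)%E.
Proof.
move=> [M [_ hM]] mD.
have {}hM x : D x -> `|x| <= M + 1 by apply: hM; rewrite ltrDl.
pose I : set (measurableTypeR R) := `[- (M + 1), M + 1]%classic.
apply: (@le_lt_trans _ _ (leb2 R (I `*` I))).
  apply: le_measure; rewrite ?inE//; first by apply: measurableX; exact: measurable_itv.
  move=> x /hM; rewrite prod_normE/= ge_max => /andP[].
  by rewrite !ler_norml => h1 h2; split; rewrite /I/= in_itv.
have mI : measurable I by exact: measurable_itv.
rewrite [X in (X < _)%E](product_measure1E _ _ mI mI).
have I0 : (0 <= lebesgue_measure I)%E by [].
have Ioo : (lebesgue_measure I < +oo)%E.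
  by rewrite /I lebesgue_measure_itv/=; case: ifP; rewrite // -EFinD ltry.
by rewrite lte_mul_pinfty// ge0_fin_numE.
Qed.

End plane.

(** * Test functions *)

Section test_functions.
Variables (R : realType) (D : set (plane R)).
Hypotheses (mD : measurable (D : set (mplane R))) (fD : (leb2 R D < +oo)%E).

Lemma derive_lin (a : R) (f g : plane R -> R^o) (v x : plane R) :
  derivable f x v -> derivable g x v ->
  'D_v (a *: f + g) x = a * 'D_v f x + 'D_v g x.
Proof.
move=> df dg; have daf : derivable (a \*: f) x v by exact: derivableZ.
exact: etrans (deriveD daf dg) (congr1 (+%R^~ _) (deriveZ a df)).
Qed.

Lemma Ck_lin k (a : R) (f g : plane R -> R^o) :
  Ck k f -> Ck k g -> Ck k (a *: f + g).
Proof.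
elim: k f g => [|k IH] f g /= [cf hf] [cg hg]; (split; first
  by move=> x; apply: cvgD; [apply: cvgZr; exact: cf|exact: cg]) => //.
case: hf => df1 df2 Cf1 Cf2; case: hg => dg1 dg2 Cg1 Cg2; split.
- by move=> x; apply: derivableD => //; exact: derivableZ.
- by move=> x; apply: derivableD => //; exact: derivableZ.
- rewrite (_ : pd1 _ = a *: pd1 f + pd1 g); first exact: IH.
  by apply/funext => x; rewrite [LHS]derive_lin.
- rewrite (_ : pd2 _ = a *: pd2 f + pd2 g); first exact: IH.
  by apply/funext => x; rewrite [LHS]derive_lin.
Qed.

Lemma test_fun_lin (a : R) (f g : plane R -> R^o) :
  test_fun D f -> test_fun D g -> test_fun D (a *: f + g).
Proof.
move=> [Cf [K [cK KD fK]]] [Cg [L [cL LD gL]]]; split.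
  by move=> k; exact: Ck_lin.
exists (K `|` L); split; first exact: compactU.
- by rewrite subUset.
- move=> x /not_orP[Kx Lx]; rewrite /= (_ : (a *: f + g) x = a * f x + g x)//.
  by rewrite fK// gL// mulr0 addr0.
Qed.

Lemma test_fun0 : test_fun D (0 : plane R -> R^o).
Proof.
split; last by exists set0; split => //; exact: compact0.
elim=> [|k IH] /=; split => //; try by move=> x; exact: cvg_cst.
have pd (v : plane R) : (fun x => 'D_v (0 : plane R -> R^o) x) = 0.
  by apply/funext => x; exact: derive_cst.
split; try (by move=> x; exact: derivable_cst);
  by rewrite /pd1 /pd2 pd.
Qed.

(** Continuity on a compact support gives boundedness, and [D] has finite measure. *)
Lemma in_L2_compact_support (K : set (plane R)) (f : plane R -> R^o) :
  compact K -> continuous f -> (forall x, ~ K x -> f x = 0) -> in_L2 D f.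
Proof.
move=> cK cf f0.
have [M [_ hM]] : bounded_set (f @` K).
  by apply/compact_bounded/continuous_compact => //; exact: continuous_subspaceT.
apply: (@square_integrable_bounded _ _ _ _ _ mD _ (`|M| + 1)) => //.
  by have := continuous_measurable_plane cf; exact: measurable_funTS.
move=> x _; have [Kx|Kx] := pselect (K x); last by rewrite f0// normr0 addr_ge0.
by apply: hM; [have := ler_norm M; lra|exists x].
Qed.

(** The derivatives vanish off the support [K] of [f] as well: [K] being closed, [f]
    vanishes near every point outside it. *)
Lemma test_fun_in_L2 (f : plane R -> R^o) : test_fun D f ->
  [/\ in_L2 D f, in_L2 D (pd1 f) & in_L2 D (pd2 f)].
Proof.
move=> [Cf [K [cK KD fK]]].
have [_ [_ _ [c1 _] [c2 _]]] := Cf 1%N.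
have c0 := (Cf 0%N).1.
have clK : closed K by apply: compact_closed => //; exact: norm_hausdorff.
have dK v x : ~ K x -> 'D_v f x = 0.
  move=> Kx; rewrite -(derive_cst (0 : R^o) x v); apply: near_eq_derive.
  have : nbhs x (~` K) by apply: open_nbhs_nbhs; split => //; exact: closed_openC.
  by apply: filterS => y Ky; rewrite fK.
split; apply: (in_L2_compact_support cK) => // x Kx; exact: dK.
Qed.

End test_functions.

(** * The space H^1_0(D) *)

Section H10.
Variables (R : realType) (D : set (plane R)).
Hypotheses (mD : measurable (D : set (mplane R))) (fD : (leb2 R D < +oo)%E).
Implicit Types u v w : H1fun R.

(** Rewriting with the next three equations, instead of leaving them to
    conversion, keeps the unfolding of the product module structure under control. *)
Lemma H1fun_lin1 (a : R) u v : (a *: u + v).1 = a *: u.1 + v.1.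
Proof. by []. Qed.

Lemma H1fun_lin21 (a : R) u v : (a *: u + v).2.1 = a *: u.2.1 + v.2.1.
Proof. by []. Qed.

Lemma H1fun_lin22 (a : R) u v : (a *: u + v).2.2 = a *: u.2.2 + v.2.2.
Proof. by []. Qed.

Definition H1_sqr v (x : plane R) : R := v.1 x ^+ 2 + v.2.1 x ^+ 2 + v.2.2 x ^+ 2.

Definition L2_triple v : Prop := [/\ in_L2 D v.1, in_L2 D v.2.1 & in_L2 D v.2.2].

(** A test function as an element of [H^1(D)], with its classical gradient. *)
Definition jet (phi : plane R -> R^o) : H1fun R := (phi, (pd1 phi, pd2 phi)).

Lemma in_L2_lin (a : R) (f g : plane R -> R^o) :
  in_L2 D f -> in_L2 D g -> in_L2 D (a *: f + g).
Proof. exact: (square_integrable_lin mD). Qed.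

Lemma in_L2_0 : in_L2 D (0 : plane R -> R^o).
Proof.
split; first exact: measurable_cst.
by under eq_fun do rewrite expr0n; exact: integrable0.
Qed.

Lemma in_L2M (f g : plane R -> R^o) : in_L2 D f -> in_L2 D g ->
  (leb2 R).-integrable D (EFin \o (fun x : mplane R => (f x : R) * (g x : R))).
Proof. exact: (square_integrableM mD). Qed.

Lemma L2_triple_subspace : vector_subspace L2_triple.
Proof.
split; first by split; exact: in_L2_0.
move=> a u v [u1 u2 u3] [v1 v2 v3].
rewrite /L2_triple H1fun_lin1 H1fun_lin21 H1fun_lin22.
by split; [exact: (in_L2_lin a u1 v1)|exact: (in_L2_lin a u2 v2)
  |exact: (in_L2_lin a u3 v3)].
Qed.

Lemma integrable_H1_sqr v : L2_triple v ->
  (leb2 R).-integrable D (EFin \o (H1_sqr v : mplane R -> R)).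
Proof.
move=> [[_ s1] [_ s2] [_ s3]].
rewrite (_ : _ \o _ = (fun x : mplane R => (v.1 x ^+ 2)%:E + (v.2.1 x ^+ 2)%:E +
  (v.2.2 x ^+ 2)%:E)%E); first by apply: integrableD => //; exact: integrableD.
by apply/funext => x; rewrite /= !EFinD.
Qed.

(** The crude bound [(a s + t) ^+ 2 <= 2 a ^+ 2 s ^+ 2 + 2 t ^+ 2] suffices to see
    that linear combinations of approximating sequences are approximating. *)
Lemma Rintegral_H1_sqr_lin (a : R) u v : L2_triple u -> L2_triple v ->
  \int[leb2 R]_(x in D) H1_sqr (a *: u + v) x <=
  (2 * a ^+ 2) * \int[leb2 R]_(x in D) H1_sqr u x +
  2 * \int[leb2 R]_(x in D) H1_sqr v x.
Proof.
move=> Lu Lv; have iu := integrable_H1_sqr Lu; have iv := integrable_H1_sqr Lv.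
have i2v : (leb2 R).-integrable D (EFin \o (fun x : mplane R => 2 * H1_sqr v x)).
  rewrite (_ : _ \o _ = (fun x : mplane R => 2%:E * (EFin \o H1_sqr v) x)%E).
    exact: integrableZl.
  by apply/funext => x; rewrite /= EFinM.
rewrite -(RintegralZl 2 mD iv) -(Rintegral_lin mD _ iu i2v).
apply: le_Rintegral => //.
- by apply: integrable_H1_sqr; exact: L2_triple_subspace.2.
- exact: integrable_lin.
- move=> x _; rewrite /H1_sqr.
  have h (s t : R) : (a * s + t) ^+ 2 <= 2 * a ^+ 2 * s ^+ 2 + 2 * t ^+ 2.
    by have := sqr_ge0 (a * s - t); nra.
  have := h (u.1 x) (v.1 x); have := h (u.2.1 x) (v.2.1 x).
  have := h (u.2.2 x) (v.2.2 x).
  rewrite H1fun_lin1 H1fun_lin21 H1fun_lin22.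
  have E (f g : plane R -> R^o) : (a *: f + g) x = a * f x + g x by [].
  rewrite !E; lra.
Qed.

Lemma in_H1_L2 v : in_H1 D v -> L2_triple v.
Proof. by case=> *; split. Qed.

Lemma in_H1_subspace : vector_subspace (in_H1 D).
Proof.
split.
  split; try exact: in_L2_0.
  move=> phi _; split; rewrite [LHS](_ : _ = 0) ?[X in - X](_ : _ = 0) ?oppr0//;
  (transitivity (\int[leb2 R]_(x in D) (0 : R));
    [by apply: eq_Rintegral => x _; rewrite /fval/gradx/grady/= mul0r
    |by rewrite Rintegral_cst// mul0r]).
move=> a u v [u1 u2 u3 wu] [v1 v2 v3 wv].
rewrite /in_H1 /fval /gradx /grady H1fun_lin1 H1fun_lin21 H1fun_lin22.
split; [exact: (in_L2_lin a u1 v1)|exact: (in_L2_lin a u2 v2)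
  |exact: (in_L2_lin a u3 v3)|].
move=> phi tphi; have [p0 p1 p2] := test_fun_in_L2 mD fD tphi.
have [wu1 wu2] := wu _ tphi; have [wv1 wv2] := wv _ tphi.
have lin (f g h : plane R -> R^o) : in_L2 D f -> in_L2 D g -> in_L2 D h ->
    \int[leb2 R]_(x in D) ((a *: f + g) x * h x : R) =
    a * (\int[leb2 R]_(x in D) (f x * h x : R)) + \int[leb2 R]_(x in D) (g x * h x : R).
  move=> Lf Lg Lh; rewrite -Rintegral_lin//; last 2 first.
  - exact: in_L2M.
  - exact: in_L2M.
  by apply: eq_Rintegral => x _; rewrite mulrA -mulrDl.
split.
- rewrite (lin u.1 v.1)// (lin u.2.1 v.2.1)//.
  by move: wu1 wv1; rewrite /fval /gradx => -> ->; rewrite mulrN opprD.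
- rewrite (lin u.1 v.1)// (lin u.2.2 v.2.2)//.
  by move: wu2 wv2; rewrite /fval /grady => -> ->; rewrite mulrN opprD.
Qed.

Lemma jet_lin (a : R) (f g : plane R -> R^o) : test_fun D f -> test_fun D g ->
  jet (a *: f + g) = a *: jet f + jet g.
Proof.
move=> [Cf _] [Cg _]; have [_ [df1 df2 _ _]] := Cf 1%N.
have [_ [dg1 dg2 _ _]] := Cg 1%N; congr (_, (_, _)).
- by apply/funext => x; exact: derive_lin.
- by apply/funext => x; exact: derive_lin.
Qed.

Lemma jet_L2 phi : test_fun D phi -> L2_triple (jet phi).
Proof. exact: (test_fun_in_L2 mD fD). Qed.

(** Linear combinations of the approximating test functions approximate the linear
    combination. *)
Lemma in_H10_subspace : vector_subspace (in_H10 D).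
Proof.
split.
  split; first exact: in_H1_subspace.1.
  exists (fun=> 0); split; first by move=> _; exact: test_fun0.
  rewrite (_ : (fun=> _) = cst 0); first exact: cvg_cst.
  apply/funext => n /=.
  transitivity (\int[leb2 R]_(x in D) (0 : R)); last first.
    by rewrite Rintegral_cst// mul0r.
  apply: eq_Rintegral => x _; rewrite /fval /gradx /grady /= /pd1 /pd2.
  by rewrite !derive_cst !subr0 !expr0n !addr0.
move=> a u v [Hu [f [tf cf]]] [Hv [g [tg cg]]]; split; first exact: in_H1_subspace.2.
exists (fun n => a *: f n + g n); split; first by move=> n; exact: test_fun_lin.
have Lu n : L2_triple (u - jet (f n)).
  apply: (subspaceB L2_triple_subspace); first exact: in_H1_L2.
  exact: jet_L2.
have Lv n : L2_triple (v - jet (g n)).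
  apply: (subspaceB L2_triple_subspace); first exact: in_H1_L2.
  exact: jet_L2.
pose I w : R := \int[leb2 R]_(x in D) H1_sqr w x.
have cb : (2 * a ^+ 2) * I (u - jet (f n)) + 2 * I (v - jet (g n)) @[n --> \oo] --> (0 : R).
  rewrite -[X in _ --> X]addr0 -{1}(mulr0 (2 * a ^+ 2)) -{2}(mulr0 2).
  apply: cvgD; apply: cvgM; [exact: cvg_cst|exact: cf|exact: cvg_cst|exact: cg].
apply: (squeeze_cvgr _ (cvg_cst 0) cb).
apply: nearW => n; apply/andP; split.
  by apply: Rintegral_ge0 => x _; rewrite !addr_ge0 ?sqr_ge0.
apply: le_trans (Rintegral_H1_sqr_lin a (Lu n) (Lv n)).
have -> : a *: (u - jet (f n)) + (v - jet (g n)) =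
    a *: u + v - jet (a *: f n + g n).
  by rewrite jet_lin// scalerBr opprD addrACA.
exact: lexx.
Qed.

End H10.

(** * Weighted gradient forms on H^1_0(D) *)

Section weighted_form.
Variables (R : realType) (D : set (plane R)).
Hypotheses (mD : measurable (D : set (mplane R))) (fD : (leb2 R D < +oo)%E).
Implicit Types (t : plane R -> R^o) (u v w : H1fun R).

Let aeF := ae_filter_ringOfSetsType (leb2 R).

Lemma normLinf_ge0 t : 0 <= normLinf D t.
Proof. by rewrite /normLinf fine_ge0// Lnorm_ge0. Qed.

(** When the whole plane is null, the norm is zero by convention, but then so is
    the set where the bound could fail. *)
Lemma in_Linf_ae t : in_Linf D t ->
  {ae leb2 R, forall x, D x -> `|t x| <= normLinf D t}.
Proof.
move=> [_ too].
have : {ae leb2 R, forall x, (`|(t \_ D) x|%:E <=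
    'N[leb2 R]_(+oo)[EFin \o ((t : mplane R -> R) \_ D)])%E}.
  rewrite unlock; case: ifPn => [_|].
    exact: (ess_sup_ge (leb2 R) (abse \o (EFin \o ((t : mplane R -> R) \_ D)))).
  rewrite -leNgt => T0; exists setT; split => //.
  by apply/eqP; rewrite eq_le T0/=.
apply: (@filterS _ _ aeF) => x tx Dx; move: tx; rewrite patchE mem_set// => tx.
by rewrite -lee_fin /normLinf fineK// ge0_fin_numE// Lnorm_ge0.
Qed.

Lemma ae_in_Linf t (M : R) : measurable_fun (D : set (mplane R)) (t : mplane R -> R) ->
  {ae leb2 R, forall x, D x -> `|t x| <= M} -> in_Linf D t.
Proof.
move=> mt tM; split => //; rewrite unlock; case: ifPn => // _.
apply: (@le_lt_trans _ _ (`|M|%:E)); last exact: ltry.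
apply/ess_supP; apply: (@filterS _ _ aeF _ _ _ tM) => x {}tM; rewrite /= lee_fin patchE.
case: ifPn => [/set_mem/tM h|_]; last by rewrite normr0.
exact: le_trans h (ler_norm _).
Qed.

Lemma in_Linf_subspace : vector_subspace (in_Linf D).
Proof.
split.
  apply: (@ae_in_Linf _ 0); first exact: measurable_cst.
  by apply: aeW => x _; rewrite normr0.
move=> a s t ls lt; have [[ms _] [mt _]] := (ls, lt).
apply: (@ae_in_Linf _ (`|a| * normLinf D s + normLinf D t)).
  by apply: measurable_funD => //; exact: measurable_funM.
have := @filterI _ _ aeF _ _ (in_Linf_ae ls) (in_Linf_ae lt).
apply: (@filterS _ _ aeF) => x [hs ht] Dx.
apply: le_trans (ler_normD _ _) _; apply: lerD; last exact: ht.
by rewrite (_ : (a *: s) x = a * s x)// normrM ler_wpM2l// hs.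
Qed.

Lemma in_Linf1 : in_Linf D (cst 1 : plane R -> R^o).
Proof.
apply: (@ae_in_Linf _ 1); first exact: measurable_cst.
by apply: aeW => x _; rewrite normr1.
Qed.

Lemma Linf_integral_le t (g : mplane R -> R) : in_Linf D t ->
  (leb2 R).-integrable D (EFin \o g) ->
  (leb2 R).-integrable D (EFin \o (fun x => t x * g x)) /\
  `|\int[leb2 R]_(x in D) (t x * g x)| <=
    normLinf D t * \int[leb2 R]_(x in D) `|g x|.
Proof.
move=> lt ig; have [mg _] := integrableP _ _ _ ig; have [mt _] := lt.
have {}mg : measurable_fun D g by exact/measurable_EFinP.
have ing : (leb2 R).-integrable D (EFin \o (fun x => `|g x|)).
  by have := integrable_norm ig.
rewrite -RintegralZl//; apply: integrable_ae_dominated => //.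
- exact: measurable_funM.
- rewrite (_ : _ \o _ = (fun x => (normLinf D t)%:E * (`|g x|%:E))%E).
    exact: integrableZl.
  by apply/funext => x; rewrite /= EFinM.
- by move=> x _; rewrite mulr_ge0// normLinf_ge0.
- apply: (@filterS _ _ aeF _ _ _ (in_Linf_ae lt)) => x tx Dx.
  by rewrite normrM ler_wpM2r// tx.
Qed.

(** The diffusion form at one parameter value; the coefficient [1] gives the inner
    product of [H^1_0(D)]. *)
Definition weighted_form t u v : R := \int[leb2 R]_(x in D)
  (t x * (gradx u x * gradx v x + grady u x * grady v x)).

Definition grad_dot u v (x : mplane R) : R :=
  gradx u x * gradx v x + grady u x * grady v x.

Lemma integrable_grad_dot u v : in_H10 D u -> in_H10 D v ->
  (leb2 R).-integrable D (EFin \o grad_dot u v).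
Proof.
move=> [/in_H1_L2[_ u1 u2] _] [/in_H1_L2[_ v1 v2] _].
rewrite (_ : _ \o _ = ((EFin \o (fun x : mplane R => (u.2.1 x : R) * (v.2.1 x : R))%R) \+
   (EFin \o (fun x : mplane R => (u.2.2 x : R) * (v.2.2 x : R))%R))%E).
  by apply: integrableD => //; exact: in_L2M.
by apply/funext => x; rewrite /= -EFinD.
Qed.

Lemma integrable_weighted t u v : in_Linf D t -> in_H10 D u -> in_H10 D v ->
  (leb2 R).-integrable D (EFin \o (fun x : mplane R => t x * grad_dot u v x)).
Proof.
by move=> lt hu hv; case: (Linf_integral_le lt (integrable_grad_dot hu hv)).
Qed.

Lemma weighted_form_sym t u v : weighted_form t u v = weighted_form t v u.
Proof.
by apply: eq_Rintegral => x _; rewrite (mulrC (gradx u x)) (mulrC (grady u x)).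
Qed.

Lemma weighted_form_lin t w : in_Linf D t -> in_H10 D w ->
  linear_on (in_H10 D) (weighted_form t ^~ w).
Proof.
move=> lt hw a u v hu hv.
rewrite -(Rintegral_lin mD a (integrable_weighted lt hu hw)
  (integrable_weighted lt hv hw)).
apply: eq_Rintegral => x _; rewrite /grad_dot.
rewrite (_ : gradx (a *: u + v) x = a * gradx u x + gradx v x)//.
rewrite (_ : grady (a *: u + v) x = a * grady u x + grady v x)//; ring.
Qed.

Lemma weighted_form_linr t w : in_Linf D t -> in_H10 D w ->
  linear_on (in_H10 D) (weighted_form t w).
Proof.
move=> lt hw a u v hu hv; rewrite !(weighted_form_sym _ w).
exact: weighted_form_lin.
Qed.

Lemma weighted_form_lin_coef u v : in_H10 D u -> in_H10 D v ->
  linear_on (in_Linf D) (fun t => weighted_form t u v).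
Proof.
move=> hu hv a s t hs ht.
rewrite -(Rintegral_lin mD a (integrable_weighted hs hu hv)
  (integrable_weighted ht hu hv)).
apply: eq_Rintegral => x _; rewrite /grad_dot.
by rewrite (_ : (a *: s + t) x = a * s x + t x)// mulrDl mulrA.
Qed.

Lemma normH10E v : normH10 D v = energy_norm (weighted_form (cst 1)) v.
Proof.
by congr Num.sqrt; apply: eq_Rintegral => x _; rewrite mul1r -!expr2.
Qed.

Lemma H10_semi_inner : semi_inner (in_H10 D) (weighted_form (cst 1)).
Proof.
split; first by move=> w; apply: weighted_form_lin; exact: in_Linf1.
  by move=> u v _ _; exact: weighted_form_sym.
by move=> v _; apply: Rintegral_ge0 => x _; rewrite mul1r addr_ge0// -expr2 sqr_ge0.
Qed.

Lemma normH10_ge0 v : 0 <= normH10 D v. Proof. exact: sqrtr_ge0. Qed.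

Lemma normH10_sqr v : in_H10 D v -> normH10 D v ^+ 2 = weighted_form (cst 1) v v.
Proof. by move=> hv; rewrite normH10E (energy_norm_sqr H10_semi_inner). Qed.

Lemma normH10Z (a : R) v : in_H10 D v -> normH10 D (a *: v) = `|a| * normH10 D v.
Proof.
by rewrite !normH10E; apply: (energy_normZ (in_H10_subspace mD fD) H10_semi_inner).
Qed.

Lemma normH10D u v : in_H10 D u -> in_H10 D v ->
  normH10 D (u + v) <= normH10 D u + normH10 D v.
Proof.
by rewrite !normH10E; apply: (energy_normD (in_H10_subspace mD fD) H10_semi_inner).
Qed.

(** The pointwise bound [|a . b| <= |a| ^+ 2 + |b| ^+ 2] for gradients, integrated
    against [t]. *)
Lemma weighted_form_le t u v : in_Linf D t -> in_H10 D u -> in_H10 D v ->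
  `|weighted_form t u v| <=
    normLinf D t * (normH10 D u ^+ 2 + normH10 D v ^+ 2).
Proof.
move=> lt hu hv; have igd := integrable_grad_dot hu hv.
have [_ le1] := Linf_integral_le lt igd.
apply: le_trans le1 _; rewrite ler_wpM2l ?normLinf_ge0// !normH10_sqr//.
have iu := integrable_weighted in_Linf1 hu hu.
have iv := integrable_weighted in_Linf1 hv hv.
rewrite -RintegralD//; apply: le_Rintegral => //.
- by have := integrable_norm igd.
- rewrite (_ : _ \o _ = ((EFin \o (fun x : mplane R => 1 * grad_dot u u x)%R) \+
   (EFin \o (fun x : mplane R => 1 * grad_dot v v x)%R))%E); first exact: integrableD.
  by apply/funext => x; rewrite /= -EFinD.
- move=> x _; rewrite /grad_dot !mul1r ler_norml.
  have := sqr_ge0 (gradx u x - gradx v x); have := sqr_ge0 (gradx u x + gradx v x).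
  have := sqr_ge0 (grady u x - grady v x); have := sqr_ge0 (grady u x + grady v x).
  have := sqr_ge0 (gradx u x); have := sqr_ge0 (gradx v x).
  have := sqr_ge0 (grady u x); have := sqr_ge0 (grady v x).
  by move=> *; apply/andP; split; nra.
Qed.

(** Boundedness in one slot, the constant depending on the other two; this is what
    passing to the limit along simple functions uses. *)
Lemma weighted_form_bounded t u : in_Linf D t -> in_H10 D u ->
  exists C : R, forall v, in_H10 D v -> `|weighted_form t u v| <= C * normH10 D v.
Proof.
move=> lt hu; exists (2 * (normLinf D t * (normH10 D u ^+ 2 + 1))).
apply: (linear_on_bounded (in_H10_subspace mD fD)).
- exact: weighted_form_linr.
- by move=> *; exact: normH10_ge0.
- exact: normH10Z.
- move=> v hv; apply: le_trans (weighted_form_le lt hu hv) _.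
  rewrite -mulrA ler_wpM2l ?normLinf_ge0//.
  have := sqr_ge0 (normH10 D u); have := sqr_ge0 (normH10 D v); nra.
Qed.

Lemma weighted_form_bounded_coef u v : in_H10 D u -> in_H10 D v ->
  exists C : R, forall t, in_Linf D t -> `|weighted_form t u v| <= C * normLinf D t.
Proof.
move=> hu hv; exists (normH10 D u ^+ 2 + normH10 D v ^+ 2) => t lt.
by rewrite mulrC; exact: weighted_form_le.
Qed.

End weighted_form.

(** * The parameter domain and polynomials on it *)

Section parameter_space.
Variable R : realType.

Lemma measurable_param_coord (m : nat) :
  measurable_fun setT (fun y : param R => param_coord y m).
Proof.
apply: (measurability _ (RGenOpens.measurableE R)).
move=> _ [_ [a [b ->] <-]]; rewrite setTI; apply: sub_sigma_algebra.
have c : continuous (fun y : {ptws nat -> R} => y m).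
  exact: (@proj_continuous nat (fun=> R) m).
by move/continuousP: c; apply; exact: interval_open.
Qed.

Lemma measurable_Gam : measurable (@Gam R).
Proof.
rewrite (_ : @Gam R = \bigcap_m ((fun y => param_coord y m) @^-1` `[-1, 1])).
  apply: bigcapT_measurable => m; rewrite -[X in measurable X]setTI.
  by apply: measurable_param_coord => //; exact: measurable_itv.
apply/seteqP; split => y hy m; first by move=> _; rewrite /= in_itv; exact: hy.
by have := hy m I; rewrite /= in_itv.
Qed.

Lemma measurable_poly_alpha (p : nat -> nat -> {poly R}) (a : multi_index) :
  measurable_fun (@Gam R) (poly_alpha p a).
Proof.
apply: measurable_prod => m _; apply: measurable_funTS.
apply: (measurableT_comp (f := fun t => (p m (a m)).[t])).
  by apply: continuous_measurable_fun; exact: continuous_horner.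
exact: measurable_param_coord.
Qed.

Lemma measurable_poly_span (p : nat -> nat -> {poly R}) (I : {fset multi_index})
    (psi : param R -> R) :
  poly_span p I psi -> measurable_fun (@Gam R) psi.
Proof.
move=> [c hc]; rewrite (_ : psi = fun y => \sum_(a <- I) c a * poly_alpha p a y).
  by apply: measurable_sum => a; apply: measurable_funM => //;
    exact: measurable_poly_alpha.
exact/funext.
Qed.

(** On [Gam] every coordinate stays in the compact interval [-1, 1]. *)
Lemma bounded_poly_alpha (p : nat -> nat -> {poly R}) (a : multi_index) :
  exists M : R, forall y, Gam y -> `|poly_alpha p a y| <= M.
Proof.
rewrite /poly_alpha; elim: (finsupp a : seq nat) => [|m s [M hM]].
  by exists 1 => y _; rewrite big_nil normr1.
have [K hK] : exists K : R, forall t, Gam1 t -> `|(p m (a m)).[t]| <= K.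
  have : bounded_set ((fun t : R => (p m (a m)).[t]) @` `[-1, 1]).
    apply/compact_bounded/continuous_compact; last exact: segment_compact.
    by apply: continuous_subspaceT; exact: continuous_horner.
  move=> [K [_ hK]]; exists (K + 1) => t ht.
  by apply: (hK (K + 1)); [rewrite ltrDl|exists t => //; rewrite /= in_itv].
exists (K * M) => y hy; rewrite big_cons normrM.
by apply: ler_pM => //; [apply: hK; exact: hy|exact: hM].
Qed.

Lemma bounded_poly_span (p : nat -> nat -> {poly R}) (I : {fset multi_index})
    (psi : param R -> R) :
  poly_span p I psi -> exists M : R, forall y, Gam y -> `|psi y| <= M.
Proof.
move=> [c hc]; suff [M hM] : exists M : R, forall y, Gam y ->
    `|\sum_(a <- I) c a * poly_alpha p a y| <= M by exists M => y /hM; rewrite -hc.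
elim: (I : seq multi_index) => [|a s [M hM]].
  by exists 0 => y _; rewrite big_nil normr0.
have [K hK] := bounded_poly_alpha p a.
exists (`|c a| * K + M) => y hy; rewrite big_cons.
apply: le_trans (ler_normD _ _) _; apply: lerD; last exact: hM.
by rewrite normrM ler_wpM2l// hK.
Qed.

Lemma poly_spanN (p : nat -> nat -> {poly R}) (I : {fset multi_index})
    (psi : param R -> R) :
  poly_span p I psi -> poly_span p I (- psi).
Proof.
move=> [c hc]; exists (- c) => y.
rewrite (_ : (- psi) y = - psi y)// hc -sumrN.
by apply: eq_bigr => a _; rewrite -mulNr.
Qed.

End parameter_space.

(** * Strongly measurable functions *)

Section strongly_measurable_theory.
Variables (R : realType) (E : lmodType R) (S : set E) (N : E -> R).
Hypotheses (hS : vector_subspace S) (N_ge0 : forall x, S x -> 0 <= N x)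
  (NZ : forall (a : R) x, S x -> N (a *: x) = `|a| * N x)
  (ND : forall x y, S x -> S y -> N (x + y) <= N x + N y).
Implicit Types u v : param R -> E.

(** The simple functions approximating the combination are the juxtapositions of
    those approximating [u] and [v]. *)
Lemma strongly_measurable_lin (a : R) u v :
  (forall y, Gam y -> S (u y)) -> (forall y, Gam y -> S (v y)) ->
  strongly_measurable S N u -> strongly_measurable S N v ->
  strongly_measurable S N (a *: u + v).
Proof.
move=> Su Sv [k [A [x [mA cx]]]] [l [B [z [mB cz]]]].
exists (fun n => k n + l n)%N.
exists (fun n i => if (i < k n)%N then A n i else B n (i - k n)%N).
exists (fun n i => if (i < k n)%N then a *: x n i else z n (i - k n)%N).
split.
  move=> n i; case: ifP => _; last exact: mB.
  by split; [exact: (mA n i).1|exact/(subspaceZ hS)/(mA n i).2].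
move=> y hy.
pose sx n := \sum_(i < k n) (\1_(A n i) y : R) *: x n i.
pose sz n := \sum_(i < l n) (\1_(B n i) y : R) *: z n i.
have Ssx n : S (u y - sx n).
  apply: (subspaceB hS); first exact: Su.
  by apply: (subspace_sum hS) => i; exact: (mA n i).2.
have Ssz n : S (v y - sz n).
  apply: (subspaceB hS); first exact: Sv.
  by apply: (subspace_sum hS) => i; exact: (mB n i).2.
have cb : `|a| * N (u y - sx n) + N (v y - sz n) @[n --> \oo] --> (0 : R).
  rewrite -[X in _ --> X]addr0 -{1}(mulr0 `|a|).
  apply: cvgD; last exact: cz.
  by apply: cvgM; [exact: cvg_cst|exact: cx].
have E1 n : (a *: u + v) y - \sum_(i < k n + l n)
    (\1_(if (i < k n)%N then A n i else B n (i - k n)%N) y : R) *: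
      (if (i < k n)%N then a *: x n i else z n (i - k n)%N) =
    a *: (u y - sx n) + (v y - sz n).
  rewrite big_split_ord /= (_ : (a *: u + v) y = a *: u y + v y)//.
  rewrite scalerBr scaler_sumr [RHS]addrACA -opprD; congr (_ - (_ + _)).
    apply: eq_bigr => i _; rewrite ltn_ord scalerA mulrC -scalerA.
    by [].
  by apply: eq_bigr => i _; rewrite ltnNge leq_addr /= addKn.
under eq_cvg do rewrite E1.
apply: (squeeze_cvgr _ (cvg_cst 0) cb); apply: nearW => n.
have Sa : S (a *: (u y - sx n)) by exact: subspaceZ.
rewrite N_ge0/=; last exact: subspaceD.
by apply: le_trans (ND Sa (Ssz n)) _; rewrite NZ.
Qed.

(** Replacing [v] by its simple approximants leaves a finite sum of products of
    measurable functions. Applied to one slot of a multilinear form after the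
    other, this yields measurability of the form along measurable arguments. *)
Lemma measurable_strongly_measurable (h : param R -> E -> R) v :
  (forall y, Gam y -> linear_on S (h y)) ->
  (forall y, Gam y -> exists C : R, forall x, S x -> `|h y x| <= C * N x) ->
  (forall x, S x -> measurable_fun (@Gam R) (h ^~ x)) ->
  (forall y, Gam y -> S (v y)) -> strongly_measurable S N v ->
  measurable_fun (@Gam R) (fun y => h y (v y)).
Proof.
move=> lh bh mh Sv [k [A [x [mA cx]]]].
apply: (@measurable_fun_cvg _ _ _ _
  (fun n y => \sum_(i < k n) (\1_(A n i) y : R) * h y (x n i))).
  move=> n; apply: measurable_sum => i; apply: measurable_funM.
    by apply: measurable_funTS; apply: measurable_indic; exact: (mA n i).1.
  by apply: mh; exact: (mA n i).2.
move=> y hy; have [C hC] := bh y hy.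
have Ssx n : S (\sum_(i < k n) (\1_(A n i) y : R) *: x n i).
  by apply: (subspace_sum hS) => i; exact: (mA n i).2.
have E1 n : \sum_(i < k n) (\1_(A n i) y : R) * h y (x n i) =
    h y (v y) - h y (v y - \sum_(i < k n) (\1_(A n i) y : R) *: x n i).
  rewrite (linear_onB (lh y hy) (Sv y hy) (Ssx n)) subKr.
  by rewrite (linear_on_sum hS (lh y hy))// => i; exact: (mA n i).2.
suff : (fun n => h y (v y) - h y (v y - \sum_(i < k n) (\1_(A n i) y : R) *: x n i))
    @ \oo --> h y (v y) - 0.
  rewrite subr0; apply: cvg_trans; apply: near_eq_cvg; apply: nearW => n.
  by rewrite -E1.
apply: cvgB; first exact: cvg_cst.
apply/norm_cvg0P.
have cb : C * N (v y - \sum_(i < k n) (\1_(A n i) y : R) *: x n i)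
    @[n --> \oo] --> (0 : R).
  rewrite -[X in _ --> X](mulr0 C).
  by apply: cvgM; [exact: cvg_cst|exact: cx].
apply: (squeeze_cvgr _ (cvg_cst 0) cb); apply: nearW => n.
rewrite normr_ge0/=; apply: hC.
exact: (subspaceB hS (Sv y hy) (Ssx n)).
Qed.

(** Scalar simple functions approximating [psi], times [x]; the pieces of such a
    function are indexed by the enumeration of its finite range. *)
Lemma strongly_measurableZ (psi : param R -> R) (x : E) :
  measurable_fun (@Gam R) psi -> S x ->
  strongly_measurable S N (fun y => psi y *: x).
Proof.
move=> mpsi Sx.
have [g cg] := approximation_sfun (@measurable_Gam R)
  ((measurable_EFinP _ _).2 mpsi).
pose s n : seq R := fset_set (range (g n)).
exists (fun n => size (s n)).
exists (fun n i => g n @^-1` [set nth 0 (s n) i]).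
exists (fun n i => nth 0 (s n) i *: x).
split.
  move=> n i; split; last exact: subspaceZ.
  exact: measurable_funPTI.
move=> y hy.
have E1 n : \sum_(i < size (s n))
    (\1_(g n @^-1` [set nth 0 (s n) i]) y : R) *: (nth 0 (s n) i *: x) =
    g n y *: x.
  under eq_bigr do rewrite scalerA mulrC.
  rewrite -scaler_suml; congr (_ *: _).
  rewrite [RHS]fimfunE fsbig_finite//= (big_nth 0) big_mkord.
  by [].
suff : (fun n => `|psi y - g n y| * N x) @ \oo --> 0 * N x.
  rewrite mul0r; apply: cvg_trans; apply: near_eq_cvg; apply: nearW => n.
  by rewrite E1 -scalerBl NZ.
apply: cvgM; last exact: cvg_cst.
apply/norm_cvg0P; rewrite -(subrr (psi y)); apply: cvgB; first exact: cvg_cst.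
by have := fine_cvg (cg y hy); apply.
Qed.

End strongly_measurable_theory.

(** * The space V, the diffusion form and the tensor product spaces *)

Section bochner.
Variables (R : realType) (D : set (plane R)).
Hypotheses (mD : measurable (D : set (mplane R))) (fD : (leb2 R D < +oo)%E).
Variable pi : probability (param R) R.
Implicit Types u v w : param R -> H1fun R.
Let V := bochner_H10 D pi.
Let hH := in_H10_subspace mD fD.
Let mG : measurable (@Gam R) := @measurable_Gam R.

(** The slots of [u] and [v] are frozen one after the other, which leaves the
    dependence on the coefficient as a hypothesis. It holds trivially for a constant
    coefficient, and by freezing once more for the diffusion coefficient. *)
Lemma measurable_weighted_form (T : param R -> plane R -> R^o) u v :
  (forall y, Gam y -> in_Linf D (T y)) ->
  (forall x z, in_H10 D x -> in_H10 D z ->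
    measurable_fun (@Gam R) (fun y => weighted_form D (T y) x z)) ->
  (forall y, Gam y -> in_H10 D (u y)) -> (forall y, Gam y -> in_H10 D (v y)) ->
  strongly_measurable (in_H10 D) (normH10 D) u ->
  strongly_measurable (in_H10 D) (normH10 D) v ->
  measurable_fun (@Gam R) (fun y => weighted_form D (T y) (u y) (v y)).
Proof.
move=> lT mT Hu Hv su sv.
apply: (measurable_strongly_measurable hH
  (h := fun y z => weighted_form D (T y) (u y) z) _ _ _ Hv sv).
- by move=> y hy; apply: weighted_form_linr => //; [exact: lT|exact: Hu].
- by move=> y hy; apply: weighted_form_bounded => //; [exact: lT|exact: Hu].
- move=> z hz; apply: (measurable_strongly_measurable hH
    (h := fun y x => weighted_form D (T y) x z) _ _ _ Hu su).
  + by move=> y hy; apply: weighted_form_lin => //; exact: lT.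
  + move=> y hy; have [C hC] := weighted_form_bounded mD fD (lT y hy) hz.
    by exists C => x hx; rewrite weighted_form_sym; exact: hC.
  + by move=> x hx; exact: mT.
Qed.

Lemma measurable_normH10_sqr v : (forall y, Gam y -> in_H10 D (v y)) ->
  strongly_measurable (in_H10 D) (normH10 D) v ->
  measurable_fun (@Gam R) (fun y => normH10 D (v y) ^+ 2).
Proof.
move=> Hv sv; apply: (eq_measurable_fun
  (fun y => weighted_form D (cst 1) (v y) (v y))).
  by move=> y /set_mem hy; rewrite normH10_sqr//; exact: Hv.
apply: (measurable_weighted_form (T := fun=> cst 1)) => // y _.
exact: in_Linf1.
Qed.

Lemma normH10_sqr_lin (a : R) (x z : H1fun R) : in_H10 D x -> in_H10 D z ->
  normH10 D (a *: x + z) ^+ 2 <= 2 * a ^+ 2 * normH10 D x ^+ 2 + 2 * normH10 D z ^+ 2.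
Proof.
move=> hx hz; have hax := subspaceZ hH a hx.
have := normH10D mD fD hax hz; rewrite normH10Z// => h.
apply: le_trans (_ : (`|a| * normH10 D x + normH10 D z) ^+ 2 <= _).
  by rewrite lerXn2r ?nnegrE ?addr_ge0 ?mulr_ge0 ?normH10_ge0.
have := sqr_ge0 (`|a| * normH10 D x - normH10 D z).
rewrite -(real_normK (num_real a)); nra.
Qed.

Lemma bochner_integrable v : V v ->
  pi.-integrable (@Gam R) (EFin \o (fun y => normH10 D (v y) ^+ 2)).
Proof. by case. Qed.

Lemma integrable_lin_bound (a : R) u v : V u -> V v ->
  pi.-integrable (@Gam R) (EFin \o (fun y =>
    2 * a ^+ 2 * normH10 D (u y) ^+ 2 + 2 * normH10 D (v y) ^+ 2)).
Proof.
move=> hu hv; have iu := bochner_integrable hu; have iv := bochner_integrable hv.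
apply: integrable_lin => //.
rewrite (_ : _ \o _ = (fun y => 2%:E * (normH10 D (v y) ^+ 2)%:E)%E).
  exact: integrableZl.
by apply/funext => x; rewrite /= EFinM.
Qed.

Lemma normH10_0 : normH10 D 0 = 0.
Proof. by rewrite -(scale0r 0) normH10Z ?normr0 ?mul0r//; exact: hH.1. Qed.

Lemma strongly_measurable_scale (psi : param R -> R) (x : H1fun R) :
  measurable_fun (@Gam R) psi -> in_H10 D x ->
  strongly_measurable (in_H10 D) (normH10 D) (fun y => psi y *: x).
Proof. by apply: strongly_measurableZ => // a z; exact: normH10Z. Qed.

Lemma bochner_subspace : vector_subspace V.
Proof.
split.
  split; first by move=> y _; exact: hH.1.
    rewrite (_ : 0 = fun y => (0 : R) *: (0 : H1fun R)).
      apply: (@strongly_measurable_scale (cst 0)); last exact: hH.1.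
      exact: measurable_cst.
    by apply/funext => y; rewrite scale0r.
  rewrite (_ : (fun y => _) = cst 0%E); first exact: integrable0.
  by apply/funext => y; rewrite /= normH10_0 expr0n.
move=> a u v hu hv; have [Hu su iu] := hu; have [Hv sv iv] := hv.
have Hw y : Gam y -> in_H10 D ((a *: u + v) y).
  by move=> hy; apply: hH.2; [exact: Hu|exact: Hv].
have sw : strongly_measurable (in_H10 D) (normH10 D) (a *: u + v).
  apply: strongly_measurable_lin => //.
  - by move=> *; exact: normH10_ge0.
  - by move=> *; exact: normH10Z.
  - by move=> *; exact: normH10D.
split => //; apply: (integrable_dominated mG _ _ (integrable_lin_bound a hu hv)).
  exact: measurable_normH10_sqr.
move=> y hy; rewrite ger0_norm ?sqr_ge0//.
by apply: normH10_sqr_lin; [exact: Hu|exact: Hv].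
Qed.

Lemma norm_bochner_sqr v :
  norm_bochner D pi v ^+ 2 = \int[pi]_(y in @Gam R) (normH10 D (v y) ^+ 2).
Proof. by rewrite sqr_sqrtr// Rintegral_ge0// => y _; rewrite sqr_ge0. Qed.

Lemma norm_bochner_sqr_lin (a : R) u v : V u -> V v ->
  norm_bochner D pi (a *: u + v) ^+ 2 <=
  2 * a ^+ 2 * norm_bochner D pi u ^+ 2 + 2 * norm_bochner D pi v ^+ 2.
Proof.
move=> hu hv; rewrite [X in X <= _]norm_bochner_sqr.
rewrite [X in _ <= _ * X + _]norm_bochner_sqr [X in _ <= _ + _ * X]norm_bochner_sqr.
have iu := bochner_integrable hu; have iv := bochner_integrable hv.
rewrite -(RintegralZl 2 mG iv) -Rintegral_lin//; last first.
  rewrite (_ : _ \o _ = (fun y => 2%:E * (normH10 D (v y) ^+ 2)%:E)%E).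
    exact: integrableZl.
  by apply/funext => x; rewrite /= EFinM.
apply: le_Rintegral => //.
- by apply: bochner_integrable; exact: bochner_subspace.2.
- exact: integrable_lin_bound.
- move=> y hy; have [Hu _ _] := hu; have [Hv _ _] := hv.
  by apply: normH10_sqr_lin; [exact: Hu|exact: Hv].
Qed.

Lemma norm_bochner0 : norm_bochner D pi 0 = 0.
Proof.
rewrite /norm_bochner (_ : \int[pi]_(y in _) _ = 0) ?sqrtr0//.
transitivity (\int[pi]_(y in @Gam R) (0 : R)).
  by apply: eq_Rintegral => y _; rewrite normH10_0 expr0n.
by rewrite Rintegral_cst// mul0r.
Qed.

(** Both arguments must lie in [V]: the integral of a nonnegative function that is
    not integrable evaluates to [0] as a real number, so that a vanishing
    [norm_bochner] alone carries no information. *)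
Lemma norm_bochner_eq0B u v : V u -> V v ->
  norm_bochner D pi u = 0 -> norm_bochner D pi v = 0 ->
  norm_bochner D pi (v - u) = 0.
Proof.
move=> hu hv nu nv; have := norm_bochner_sqr_lin (-1) hu hv.
rewrite nu nv expr0n !mulr0 addr0 scaleN1r (addrC (- u)) => h.
by apply/eqP; rewrite -sqrf_eq0 eq_le h sqr_ge0.
Qed.

Section diffusion.
Variables (T : param R -> plane R -> R^o) (hT : bochner_Linf D pi T).
Let B := diffusion_form D pi T.

Lemma measurable_diffusion u v : V u -> V v ->
  measurable_fun (@Gam R) (fun y => weighted_form D (T y) (u y) (v y)).
Proof.
case: hT => lT sT _ [Hu su _] [Hv sv _]; apply: measurable_weighted_form => //.
move=> x z hx hz; refine (@measurable_strongly_measurable R _ (in_Linf D) (normLinf D)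
  (in_Linf_subspace D) (fun y t => weighted_form D t x z) T _ _ _ lT sT).
- by move=> y _; exact: weighted_form_lin_coef.
- by move=> y _; exact: weighted_form_bounded_coef.
- by move=> t _; exact: measurable_cst.
Qed.

(** The bound [M] on the coefficient holds for almost every parameter, hence
    [weighted_form_le] dominates the integrand almost everywhere. *)
Lemma diffusion_integrable_bound : exists M : R, forall u v, V u -> V v ->
  pi.-integrable (@Gam R) (EFin \o (fun y => weighted_form D (T y) (u y) (v y))) /\
  `|B u v| <= M * (norm_bochner D pi u ^+ 2 + norm_bochner D pi v ^+ 2).
Proof.
have [lT sT [M hM]] := hT; exists `|M| => u v hu hv.
have iu := bochner_integrable hu; have iv := bochner_integrable hv.
have iuv : pi.-integrable (@Gam R)
    (EFin \o (fun y => normH10 D (u y) ^+ 2 + normH10 D (v y) ^+ 2)).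
  rewrite (_ : _ \o _ = (fun y => (normH10 D (u y) ^+ 2)%:E +
    (normH10 D (v y) ^+ 2)%:E)%E); first exact: integrableD.
  by apply/funext => x; rewrite /= EFinD.
rewrite [X in _ * (X + _)]norm_bochner_sqr [X in _ * (_ + X)]norm_bochner_sqr.
rewrite -RintegralD// -RintegralZl//.
apply: integrable_ae_dominated => //.
- exact: measurable_diffusion.
- rewrite (_ : _ \o _ = (fun y => `|M|%:E *
    (normH10 D (u y) ^+ 2 + normH10 D (v y) ^+ 2)%:E)%E); first exact: integrableZl.
  by apply/funext => x; rewrite /= EFinM.
- by move=> y _; rewrite mulr_ge0// addr_ge0// sqr_ge0.
- apply: filterS hM => y hy Gy; have [Hu _ _] := hu; have [Hv _ _] := hv.
  apply: le_trans (weighted_form_le mD (lT y Gy) (Hu y Gy) (Hv y Gy)) _.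
  by rewrite ler_wpM2r ?addr_ge0 ?sqr_ge0// (le_trans (hy Gy))// ler_norm.
Qed.

Lemma diffusion_lin w : V w -> linear_on V (B^~ w).
Proof.
move=> hw a u v hu hv; have [M hM] := diffusion_integrable_bound.
rewrite [RHS](_ : _ = a * (\int[pi]_(y in @Gam R) weighted_form D (T y) (u y) (w y)) +
  \int[pi]_(y in @Gam R) weighted_form D (T y) (v y) (w y))//.
rewrite -Rintegral_lin//; [|exact: (hM _ _ hu hw).1|exact: (hM _ _ hv hw).1].
apply: eq_Rintegral => y /set_mem hy.
case: hu => Hu _ _; case: hv => Hv _ _; case: hw => Hw _ _; case: hT => lT _ _.
exact: (weighted_form_lin mD (lT y hy) (Hw y hy) a (Hu y hy) (Hv y hy)).
Qed.

Lemma diffusion_sym u v : B u v = B v u.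
Proof. by apply: eq_Rintegral => y _; exact: weighted_form_sym. Qed.

Lemma diffusion_eq0 v : V v -> norm_bochner D pi v = 0 -> B v v = 0.
Proof.
move=> hv nv; have [M hM] := diffusion_integrable_bound.
have [_] := hM v v hv hv; rewrite nv expr0n addr0 mulr0 => h.
by apply/eqP; rewrite -normr_eq0 eq_le h normr_ge0.
Qed.

End diffusion.

Section tensor.
Variables (p : nat -> nat -> {poly R}) (X : set (H1fun R)).
Hypothesis XH : X `<=` in_H10 D.

(** A polynomial is measurable and bounded on [Gam], so its product with a fixed
    element of [H^1_0(D)] is strongly measurable and square-integrable. *)
Lemma bochner_simple_tensor (I : {fset multi_index}) (psi : param R -> R) x :
  poly_span p I psi -> X x -> V (fun y => psi y *: x).
Proof.
move=> hpsi /XH hx; have mpsi := measurable_poly_span hpsi.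
have [M hM] := bounded_poly_span hpsi.
have sv := strongly_measurable_scale mpsi hx.
have Hv y : Gam y -> in_H10 D (psi y *: x) by move=> _; exact: subspaceZ.
split => //; apply: (integrable_dominated mG (g := cst (M ^+ 2 * normH10 D x ^+ 2))).
- exact: measurable_normH10_sqr.
- move=> y hy; rewrite ger0_norm ?sqr_ge0// normH10Z// exprMn.
  by rewrite ler_wpM2r ?sqr_ge0// lerXn2r ?nnegrE ?hM// (le_trans _ (hM y hy)).
- exact: finite_measure_integrable_cst.
Qed.

Lemma bochner_tensor_sum (I : {fset multi_index}) (n : nat)
    (x : 'I_n -> H1fun R) (psi : 'I_n -> param R -> R) :
  (forall i, X (x i) /\ poly_span p I (psi i)) ->
  V (fun y => \sum_(i < n) psi i y *: x i).
Proof.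
move=> h; rewrite (_ : (fun y => _) = \sum_(i < n) (fun y => psi i y *: x i)).
  elim/big_ind: _ => [|u v|i _]; first exact: bochner_subspace.1.
    exact: subspaceD bochner_subspace _ _.
  by apply: bochner_simple_tensor (h i).2 (h i).1.
by apply/funext => y; rewrite fct_sumE.
Qed.

Lemma tensor_space0 (I : {fset multi_index}) :
  tensor_space D pi X (poly_span p I) 0.
Proof.
split; first exact: bochner_subspace.1.
exists 0%N, (fun=> 0), (fun=> 0); split; first by case.
rewrite (_ : 0 - _ = 0) ?norm_bochner0//.
by apply/funext => y; rewrite sub0r /= (_ : (- _) y = - \sum_(i < 0) 0 *: 0)//
  big_ord0 oppr0.
Qed.

(** The representing sum of the difference juxtaposes the two given ones, with the
    polynomials of the second negated. *)
Lemma tensor_spaceB (I : {fset multi_index}) v w :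
  tensor_space D pi X (poly_span p I) v -> tensor_space D pi X (poly_span p I) w ->
  tensor_space D pi X (poly_span p I) (v - w).
Proof.
move=> [hv [n [x [psi [hx nv]]]]] [hw [m [z [phi [hz nw]]]]].
have hs := bochner_tensor_sum hx; have ht := bochner_tensor_sum hz.
split; first exact: (subspaceB bochner_subspace hv hw).
exists (n + m)%N.
exists (fun i => match fintype.split i with inl j => x j | inr j => z j end).
exists (fun i => match fintype.split i with inl j => psi j | inr j => - phi j end).
split.
  move=> i; case: (fintype.split i) => j; first exact: hx.
  by split; [exact: (hz j).1|apply: poly_spanN; exact: (hz j).2].
set s : param R -> H1fun R := fun y => \sum_(i < n) psi i y *: x i in nv hs.
set t : param R -> H1fun R := fun y => \sum_(i < m) phi i y *: z i in nw ht.
rewrite [X in v - w - X](_ : _ = s - t).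
  rewrite opprD addrACA -opprD; apply: norm_bochner_eq0B nw nv.
    exact: (subspaceB bochner_subspace hw ht).
  exact: (subspaceB bochner_subspace hv hs).
apply/funext => y; rewrite [RHS](_ : _ = s y - t y)// big_split_ord /=.
congr (_ + _).
  by apply: eq_bigr => i _; rewrite (unsplitK (inl i)).
rewrite /t -sumrN; apply: eq_bigr => i _; rewrite (unsplitK (inr i)).
by rewrite (_ : (- phi i) y = - phi i y)// scaleNr.
Qed.

End tensor.
End bochner.

(** * The two forms as semidefinite inner products on V *)

Section forms_on_V.
Variables (R : realType) (D : set (plane R)).
Hypotheses (mD : measurable (D : set (mplane R))) (fD : (leb2 R D < +oo)%E).
Variable pi : probability (param R) R.
Let V := bochner_H10 D pi.

Lemma findim_subspace_in_H10 (X : set (H1fun R)) :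
  findim_subspace D X -> X `<=` in_H10 D.
Proof. by case=> n [b [_ ->]] x []. Qed.

Lemma elliptic_semi_inner (b : (param R -> H1fun R) -> (param R -> H1fun R) -> R) :
  sym_cont_elliptic_form D pi b -> semi_inner V b.
Proof.
case=> lb sb _ [c [c0 eb]]; split.
- by move=> w hw a u v hu hv; exact: lb.
- exact: sb.
- by move=> v hv; apply: le_trans (eb v hv); rewrite mulr_ge0 ?sqr_ge0// ltW.
Qed.

(** Nonnegativity is read off from the comparison with the elliptic form [b]: when
    [v] has positive norm, [b v v > 0], and [energy_norm (diffusion_form D pi T) v]
    would be [0] if the form were negative at [v]. *)
Lemma diffusion_semi_inner (T : param R -> plane R -> R^o)
    (b : (param R -> H1fun R) -> (param R -> H1fun R) -> R) (Lam : R) :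
  bochner_Linf D pi T -> sym_cont_elliptic_form D pi b ->
  (forall v, V v -> energy_norm b v <= Lam * energy_norm (diffusion_form D pi T) v) ->
  semi_inner V (diffusion_form D pi T).
Proof.
move=> hT [_ _ _ [c [c0 eb]]] hLam; split.
- by move=> w hw; exact: diffusion_lin.
- by move=> u v _ _; exact: diffusion_sym.
- move=> v hv; have [nv|nv] := eqVneq (norm_bochner D pi v) 0.
    by rewrite (diffusion_eq0 mD fD hT hv nv).
  have bv : 0 < b v v.
    apply: lt_le_trans (eb v hv); rewrite mulr_gt0// exprn_gt0//.
    by rewrite lt0r nv sqrtr_ge0.
  have := hLam v hv; rewrite leNgt => /negP h; rewrite leNgt; apply/negP => Bv.
  apply: h; rewrite [X in _ * X](_ : _ = 0) ?mulr0 ?sqrtr_gt0//.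
  by rewrite /energy_norm ltr0_sqrtr.
Qed.

End forms_on_V.

(** * The error estimate *)

Theorem theorem3p1 (R : realType)
  (* spatial domain *)
  (D : set (plane R)) (hD : lipschitz_polygonal_domain D)
  (* parameter measure *)
  (q : nat -> R -> R) (pim : nat -> probability (measurableTypeR R) R)
  (hpim : forall m, has_density (pim m) (q m))
  (pi : probability (param R) R) (hpi : is_product_measure pim pi)
  (* data *)
  (f : H1fun R -> R) (hf : in_Hm1 D f)
  (T : param R -> plane R -> R^o) (hT : bochner_Linf D pi T)
  (amin amax : R) (hamin : 0 < amin)
  (hTbd : {ae (leb2 R \x pi)%E, forall xy, D xy.1 -> Gam xy.2 ->
             amin <= T xy.2 xy.1 <= amax})
  (* auxiliary form *)
  (Bt : (param R -> H1fun R) -> (param R -> H1fun R) -> R)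
  (hBt : sym_cont_elliptic_form D pi Bt)
  (* discrete spaces *)
  (p : nat -> nat -> {poly R})
  (hp : forall m, orthonormal_polys (pim m) (p m))
  (P Q : {fset multi_index})
  (hPQ : (P `&` Q)%fset = fset0) (hP0 : zero_index \in P)
  (X Y : set (H1fun R))
  (hX : findim_subspace D X) (hY : findim_subspace D Y)
  (hXY : forall x, X x -> Y x -> normH10 D x = 0) :
  let V := bochner_H10 D pi in
  let B := diffusion_form D pi T in
  let F := load_functional pi f in
  let nB := energy_norm B in
  let nBt := energy_norm Bt in
  let VXP := tensor_space D pi X (poly_span p P) in
  let VYP := tensor_space D pi Y (poly_span p P) in
  let VXQ := tensor_space D pi X (poly_span p Q) in
  let VXsP := sum_space VXP VYP in
  let VsXP := sum_space (sum_space VXP VYP) VXQ in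
  forall (u uXP usXP : param R -> H1fun R)
    (hu : V u) (hu_eq : forall v, V v -> B u v = F v)
    (huXP : VXP uXP) (huXP_eq : forall v, VXP v -> B uXP v = F v)
    (husXP : VsXP usXP) (husXP_eq : forall v, VsXP v -> B usXP v = F v)
    (beta : R) (hbeta : 0 <= beta < 1)
    (hsat : nB (u - usXP) <= beta * nB (u - uXP))
    (lam Lam : R) (hlam : 0 < lam) (hLam : 0 < Lam)
    (hequiv : forall v, V v -> lam * nB v <= nBt v <= Lam * nB v)
    (k1 k2 : R) (hk1 : 0 <= k1 < 1) (hk2 : 0 <= k2 < 1)
    (hCS1 : forall w v, VXsP w -> VXQ v -> `|Bt w v| <= k1 * nBt w * nBt v)
    (hCS2 : forall w v, VXP w -> VYP v -> `|Bt w v| <= k2 * nBt w * nBt v)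
    (eYP eXQ : param R -> H1fun R)
    (heYP : VYP eYP) (heYP_eq : forall v, VYP v -> Bt eYP v = F v - B uXP v)
    (heXQ : VXQ eXQ) (heXQ_eq : forall v, VXQ v -> Bt eXQ v = F v - B uXP v),
  let eta := Num.sqrt (nBt eYP ^+ 2 + nBt eXQ ^+ 2) in
  (lam / Num.sqrt 2 * eta <= nB (u - uXP)
     <= Lam / (Num.sqrt (1 - beta ^+ 2) * Num.sqrt ((1 - k1) * (1 - k2 ^+ 2)))
        * eta) /\
  (k1 = 0 ->
   lam * eta <= nB (u - uXP)
     <= Lam / (Num.sqrt (1 - beta ^+ 2) * Num.sqrt (1 - k2 ^+ 2)) * eta).
Proof.
move=> V B F nB nBt VXP VYP VXQ VXsP VsXP u uXP usXP hu hu_eq huXP huXP_eq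
  husXP husXP_eq beta hbeta hsat lam Lam hlam hLam hequiv k1 k2 hk1 hk2 hCS1 hCS2
  eYP eXQ heYP heYP_eq heXQ heXQ_eq eta.
have [[_ oD] _ bD _ _] := hD.
have mD := open_measurable_plane oD; have fD := bounded_leb2_finite bD mD.
have hV : vector_subspace V := bochner_subspace mD fD pi.
have sBt : semi_inner V Bt := elliptic_semi_inner hBt.
have hB : semi_inner V B.
  by apply: (diffusion_semi_inner mD fD hT hBt (Lam := Lam)) => v /hequiv/andP[].
have XH := findim_subspace_in_H10 hX.
have XP0 : VXP 0 := tensor_space0 mD fD pi p X P.
have XPB v w : VXP v -> VXP w -> VXP (v - w) := @tensor_spaceB _ _ mD fD pi p X XH P v w.
have XPV : VXP `<=` V by move=> v [].
have YPV : VYP `<=` V by move=> v [].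
have XQV : VXQ `<=` V by move=> v [].
have upper := estimator_upper hV hB sBt XPV YPV XQV XPB hu hu_eq huXP huXP_eq
  hLam hequiv heYP heYP_eq heXQ heXQ_eq hk1 hk2 hCS1 hCS2 husXP husXP_eq
  hbeta hsat.
split.
  rewrite upper andbT.
  exact: (estimator_lower_sqrt2 hV hB sBt XPV YPV XQV hu hu_eq huXP
    hlam hequiv heYP heYP_eq heXQ heXQ_eq).
move=> k10; move: upper; rewrite k10 subr0 mul1r => ->; rewrite andbT.
apply: (estimator_lower_orth hV hB sBt XPV YPV XQV XP0 hu hu_eq huXP
  hlam hequiv heYP heYP_eq heXQ heXQ_eq) => w v hw hv.
by have := hCS1 w v hw hv; rewrite k10 !mul0r.
Qed.
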